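(* Let $\mathcal F$ be a singular foliation on a smooth manifold $M$ that admits a geometric resolution of finite length in a neighborhood of $m\in M$. Equip $H^\bullet(\mathcal F,m)=\bigoplus_{i\ge1}H^{-i}(\mathcal F,m)$ with the isotropy Lie $\infty$-algebra brackets $(\{\dots\}_k)_{k\ge2}$ constructed out of some universal Lie $\infty$-algebroid $(E,Q)$ of $\mathcal F$ (near $m$) which is minimal at $m$. Then: 1. The restriction of the $2$-ary bracket $\{\cdot,\cdot\}_2:H^{-1}(\mathcal F,m)\otimes H^{-2}(\mathcal F,m)\to H^{-2}(\mathcal F,m)$ makes $H^{-2}(\mathcal F,m)$ a module over the isotropy Lie algebra $H^{-1}(\mathcal F,m)$, and this module structure does not depend on the choice of $(E,Q)$. 2. The restriction of the $3$-ary bracket $\{\cdot,\cdot,\cdot\}_3:\Lambda^3H^{-1}(\mathcal F,m)\to H^{-2}(\mathcal F,m)$ is a $3$-cocycle for the Chevalley–Eilenberg complex of $H^{-1}(\mathcal F,m)$ valued in $H^{-2}(\mathcal F,m)$. 3. The cohomology class of this cocycle does not depend on the choice of $(E,Q)$.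
   Context: $\mathscr O$: smooth functions on $M$; $\Gamma(\cdot)$: sheaves of sections. A singular foliation is a subsheaf $\mathcal F$ of the sheaf of vector fields consisting of $\mathscr O$-modules, closed under Lie bracket and locally finitely generated. Geometric resolution $(E,\mathrm d,\rho)$ of $\mathcal F$: vector bundles $E_{-i}$, $i\ge1$, vector bundle morphisms $\mathrm d^{(i)}:E_{-i}\to E_{-i+1}$ ($i\ge2$), $\rho:E_{-1}\to TM$ over the identity with $\cdots\to\Gamma(E_{-2})\xrightarrow{\mathrm d^{(2)}}\Gamma(E_{-1})\xrightarrow{\rho}\mathcal F\to0$ an exact sequence of sheaves. Finite length: $E_{-i}=0$ for $i$ large. Minimal at $m$: $\mathrm d^{(i)}_m=0$ for all $i\ge2$. $H^\bullet(\mathcal F,m)$ is the cohomology of $\cdots\to E_{-3}|_m\to E_{-2}|_m\xrightarrow{\mathrm d^{(2)}_m}\ker(\rho_m)\to0$ (with $\ker\rho_m$ in degree $-1$); it is canonically independent of the resolution. For a resolution minimal at $m$, $H^{-i}(\mathcal F,m)=E_{-i}|_m$ for $i\ge2$, $H^{-1}(\mathcal F,m)=\ker\rho_m$. Lie $\infty$-algebra: graded vector space $V=\bigoplus_{i\ge1}V_{-i}$ with graded-symmetric $n$-ary brackets $\{\dots\}_n$ ($n\ge1$) of degree $+1$ with $\sum_{i=1}^n\sum_{\sigma\in\mathrm{Un}(i,n-i)}\epsilon(\sigma)\{\{x_{\sigma(1)},\dots,x_{\sigma(i)}\}_i,x_{\sigma(i+1)},\dots,x_{\sigma(n)}\}_{n-i+1}=0$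 for all $n\ge1$ (unshuffles, Koszul sign). Brackets of elements of degree $-1$ are thus skew-symmetric. Lie $\infty$-algebroid: vector bundles $E=(E_{-i})_{i\ge1}$ with a Lie $\infty$-algebra structure on sections and an anchor $\rho:E_{-1}\to TM$, all brackets $\mathscr O$-multilinear except $\{x,fy\}_2=f\{x,y\}_2+\rho(x)[f]y$ for $x\in\Gamma(E_{-1})$; $Q$ denotes the dual degree $+1$ homological derivation of $\Gamma(S(E^* ))$. It is universal for $\mathcal F$ if its linear part $(E,\mathrm d=\{\cdot\}_1,\rho)$ is a geometric resolution of $\mathcal F$; minimal at $m$ if that resolution is. Isotropy Lie $\infty$-algebra at $m$: for a universal Lie $\infty$-algebroid minimal at $m$, the brackets restrict to $\ker(\rho_m)\oplus\bigoplus_{i\ge2}E_{-i}|_m=H^\bullet(\mathcal F,m)$ (extend elements to local sections, take the bracket, evaluate at $m$) and give a Lie $\infty$-algebra structure on $H^\bullet(\mathcal F,m)$ with $\{\cdot\}_1=0$. In particular $H^{-1}(\mathcal F,m)$ with $\{\cdot,\cdot\}_2$ is a Lie algebra, the isotropy Lie algebra. *)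

(* Defs.v *)
From HB Require Import structures.
From mathcomp Require Import all_boot all_order all_algebra all_fingroup.
From mathcomp Require Import all_classical all_reals all_analysis.

Set Implicit Arguments.
Unset Strict Implicit.
Unset Printing Implicit Defensive.

Import Order.TTheory GRing.Theory Num.Theory.
Import numFieldNormedType.Exports.

Local Open Scope classical_set_scope.
Local Open Scope ring_scope.

(** Functions and sections over an open set V are represented by total
    functions on M of which only the restriction to V matters: predicates are
    indexed by V, and two representatives define the same section over V when
    they agree on V. *)

Section Smooth.
Variables (R : realType) (n : nat).

Fixpoint Ck (k : nat) (W : set 'rV[R]_n) (f : 'rV[R]_n -> R) : Prop :=
  (forall x, W x -> {for x, continuous f}) /\
  if k is k'.+1 then
    forall i : 'I_n, (forall x, W x -> derivable f x (delta_mx 0 i)) /\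
      Ck k' W (fun x => 'D_(delta_mx 0 i) f x)
  else True.

Definition Cinfty (W : set 'rV[R]_n) (f : 'rV[R]_n -> R) := forall k, Ck k W f.

End Smooth.

Record chart (R : realType) (n : nat) (T : topologicalType) := Chart {
  chart_dom : set T;
  chart_map : T -> 'rV[R]_n;
  chart_inv : 'rV[R]_n -> T;
  chart_dom_open : open chart_dom;
  chart_img_open : open (chart_map @` chart_dom);
  chart_mapK : forall p, chart_dom p -> chart_inv (chart_map p) = p;
  chart_map_cont : {within chart_dom, continuous chart_map};
  chart_inv_cont : {within chart_map @` chart_dom, continuous chart_inv} }.

Record manifold (R : realType) := Manifold {
  mcarrier :> topologicalType;
  mdim : nat;
  atlas : set (chart R mdim mcarrier);
  mhausdorff : hausdorff_space mcarrier;
  msecond_countable : @second_countable mcarrier;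
  atlas_cover : forall p, exists2 c, atlas c & chart_dom c p;
  atlas_compat : forall c c', atlas c -> atlas c' -> forall j,
    Cinfty (chart_map c @` (chart_dom c `&` chart_dom c'))
      (fun y => chart_map c' (chart_inv c y) 0 j) }.

Definition smooth_on (R : realType) (M : manifold R) (V : set M) (f : M -> R) :=
  forall c, atlas c ->
    Cinfty (chart_map c @` (chart_dom c `&` V)) (f \o chart_inv c).

Definition smooth_at (R : realType) (M : manifold R) (p : M) (f : M -> R) :=
  exists V : set M, [/\ open V, V p & smooth_on V f].

Definition locally_on (T : topologicalType) (V : set T) (P : set T -> Prop) :=
  forall p, V p -> exists W, [/\ open W, W p, W `<=` V & P W].

(** Tangent vectors are derivations of germs of smooth functions. The value on
    functions that are not smooth near p carries no information and is
    normalized to 0, so that equality of tangent vectors is Leibniz equality. *)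

Definition derivation_at (R : realType) (M : manifold R) (p : M)
    (v : (M -> R) -> R^o) : Prop :=
  [/\ forall f g, smooth_at p f -> (\near p, f p = g p) -> v f = v g,
      forall a f g, smooth_at p f -> smooth_at p g ->
        v (fun q => a * f q + g q) = a * v f + v g,
      forall f g, smooth_at p f -> smooth_at p g ->
        v (fun q => f q * g q) = f p * v g + g p * v f
    & forall f, ~ smooth_at p f -> v f = 0].

Section Tangent.
Variables (R : realType) (M : manifold R) (p : M).

Definition tangent_pred : {pred ((M -> R) -> R^o)} :=
  fun v => `[< derivation_at p v >].

Lemma tangent_submod_closed : submod_closed tangent_pred.
Proof.
split; first by apply/asboolP; split => // *; rewrite ?mulr0 ?addr0.
move=> a u v /asboolP[u1 u2 u3 u4] /asboolP[v1 v2 v3 v4].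
have E f : (a *: u + v) f = a * u f + v f by [].
apply/asboolP; split => [f g sf fg|b f g sf sg|f g sf sg|f sf]; rewrite !E.
- by rewrite (u1 f g) // (v1 f g).
- by rewrite u2 // v2 // !mulrDr addrACA mulrCA.
- rewrite u3 // v3 // !mulrDr addrACA.
  by rewrite !(mulrCA a).
- by rewrite u4 // v4 // mulr0 addr0.
Qed.

HB.instance Definition _ :=
  GRing.isSubmodClosed.Build R ((M -> R) -> R^o) tangent_pred
    tangent_submod_closed.

Record tangent := Tangent {
  tangent_val :> (M -> R) -> R^o;
  tangent_valP : tangent_val \in tangent_pred }.

HB.instance Definition _ := [isSub for tangent_val].
HB.instance Definition _ := [Choice of tangent by <:].
HB.instance Definition _ := [SubChoice_isSubLmodule of tangent by <:].

End Tangent.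

Definition vfield (R : realType) (M : manifold R) := forall p : M, tangent p.

Section VectorFields.
Variables (R : realType) (M : manifold R).
Implicit Types (V W : set M) (X Y Z : vfield M).

Definition smooth_vfield V X :=
  forall W f, open W -> W `<=` V -> smooth_on W f ->
    smooth_on W (fun p => X p f).

Definition is_lie_bracket V X Y Z :=
  forall W f, open W -> W `<=` V -> smooth_on W f -> forall p, W p ->
    Z p f = X p (fun q => Y q f) - Y p (fun q => X q f).

End VectorFields.

(* sf_sec F V is the set of sections of the sheaf over the open set V *)
Record singular_foliation (R : realType) (M : manifold R) := SingularFoliation {
  sf_sec :> set M -> set (vfield M);
  sf_smooth : forall V X, open V -> sf_sec V X -> smooth_vfield V X;
  sf_ext : forall V X Y, open V -> (forall p, V p -> X p = Y p) ->
    sf_sec V X -> sf_sec V Y;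
  sf_restr : forall V W X, open V -> open W -> W `<=` V ->
    sf_sec V X -> sf_sec W X;
  sf_glue : forall V X, open V ->
    locally_on V (fun W => sf_sec W X) -> sf_sec V X;
  sf_zero : forall V, open V -> sf_sec V (fun _ => 0);
  sf_lin : forall V f X Y, open V -> smooth_on V f ->
    sf_sec V X -> sf_sec V Y -> sf_sec V (fun p => f p *: X p + Y p);
  sf_bracket : forall V X Y, open V -> sf_sec V X -> sf_sec V Y ->
    exists2 Z, sf_sec V Z & is_lie_bracket V X Y Z;
  sf_fingen : forall p, exists U k (X : 'I_k -> vfield M),
    [/\ open U, U p, forall j, sf_sec U (X j)
      & forall V Y, open V -> V `<=` U -> sf_sec V Y ->
          locally_on V (fun W => exists2 f : 'I_k -> M -> R,
            forall j, smooth_on W (f j)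
            & forall q, W q -> Y q = \sum_j f j q *: X j q)] }.

(* bundle over U only: the fibres outside of U are irrelevant; the rank is
   locally constant *)

Record trivialization (R : realType) (M : manifold R) (fib : M -> lmodType R) :=
  Trivialization {
  triv_rank : nat;
  triv_dom : set M;
  triv_map : forall p, {linear fib p -> 'rV[R]_triv_rank};
  triv_inv : forall p, 'rV[R]_triv_rank -> fib p;
  triv_dom_open : open triv_dom;
  triv_mapK : forall p, triv_dom p -> cancel (triv_map p) (@triv_inv p);
  triv_invK : forall p, triv_dom p -> cancel (@triv_inv p) (triv_map p) }.

Arguments triv_inv {R M fib} t p _.

Record vbundle (R : realType) (M : manifold R) (U : set M) := VBundle {
  fib :> M -> lmodType R;
  vb_atlas : set (trivialization fib);
  vb_sub : forall t, vb_atlas t -> triv_dom t `<=` U;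
  vb_cover : forall p, U p -> exists2 t, vb_atlas t & triv_dom t p;
  vb_compat : forall t t', vb_atlas t -> vb_atlas t' -> forall j k,
    smooth_on (triv_dom t `&` triv_dom t')
      (fun p => triv_map t' p (triv_inv t p (delta_mx 0 j)) 0 k) }.

Section Bundles.
Variables (R : realType) (M : manifold R).

Definition smooth_section (U : set M) (E : vbundle U) (V : set M)
    (s : forall p, E p) :=
  forall t, vb_atlas t -> forall j,
    smooth_on (V `&` triv_dom t) (fun p => triv_map t p (s p) 0 j).

Definition zero_bundle (U : set M) (E : vbundle U) :=
  forall p, U p -> forall x : E p, x = 0.

(* vector bundle morphism over the identity of the open set V *)
Definition bundle_morphism (U U' : set M) (E : vbundle U) (E' : vbundle U')
    (V : set M) (phi : forall p, E p -> E' p) :=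
  (forall p, V p -> forall a (x y : E p),
     phi p (a *: x + y) = a *: phi p x + phi p y) /\
  (forall W s, open W -> W `<=` V -> smooth_section W s ->
     smooth_section W (fun p => phi p (s p))).

End Bundles.

(* ac_bundle C i is E_{-i} (so E_0 = 0) and ac_d C i is the map
   d^{(i+1)} : E_{-i-1} -> E_{-i}, which is only relevant for i >= 1. *)

Record anchored_bundles (R : realType) (M : manifold R) (U : set M) :=
  AnchoredBundles {
  ac_bundle :> nat -> vbundle U;
  ac_bundle0 : zero_bundle (ac_bundle 0);
  ac_d : forall i p, {linear ac_bundle i.+1 p -> ac_bundle i p};
  ac_d_smooth : forall i, bundle_morphism U (fun p => ac_d i p);
  ac_rho : forall p, {linear ac_bundle 1 p -> tangent p};
  ac_rho_smooth : forall V (s : forall p, ac_bundle 1 p), open V -> V `<=` U ->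
    smooth_section V s -> smooth_vfield V (fun p => ac_rho p (s p)) }.

Section Resolutions.
Variables (R : realType) (M : manifold R) (U : set M).
Implicit Types (F : singular_foliation M) (C : anchored_bundles U).

(* exactness as sheaves at F, at E_{-1} and at E_{-i-1} for i >= 1 *)
Definition geometric_resolution F C :=
  [/\ forall V (X : vfield M), open V -> V `<=` U ->
        F V X <-> locally_on V (fun W => exists2 s : forall p, C 1%N p,
          smooth_section W s & forall q, W q -> ac_rho C q (s q) = X q),
      forall V (s : forall p, C 1%N p), open V -> V `<=` U ->
        smooth_section V s ->
        (forall p, V p -> ac_rho C p (s p) = 0) <->
        locally_on V (fun W => exists2 t : forall p, C 2%N p,
          smooth_section W t & forall q, W q -> ac_d C 1 q (t q) = s q)
    & forall i V (s : forall p, C i.+1 p), (0 < i)%N -> open V -> V `<=` U ->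
        smooth_section V s ->
        (forall p, V p -> ac_d C i p (s p) = 0) <->
        locally_on V (fun W => exists2 t : forall p, C i.+2 p,
          smooth_section W t & forall q, W q -> ac_d C i.+1 q (t q) = s q)].

Definition finite_length C :=
  exists N, forall i, (N <= i)%N -> zero_bundle (C i).

Definition minimal_at C (m : M) :=
  forall i (x : C i.+1 m), (0 < i)%N -> ac_d C i m x = 0.

End Resolutions.

Section Unshuffles.
Variables (R : realType) (n : nat).

Definition unshuffle (i : nat) (s : 'S_n) : bool :=
  [forall a : 'I_n, forall b : 'I_n,
     (a < b)%N && ((b < i)%N || (i <= a)%N) ==> (s a < s b)%N].

(* x_(s 0) ... x_(s n.-1) = koszul k s x_0 ... x_n.-1 in the graded symmetric
   algebra, when x_j has degree - k j *)
Definition koszul (k : 'I_n -> nat) (s : 'S_n) : R :=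
  \prod_(a < n) \prod_(b < n | (a < b)%N && (s b < s a)%N)
    (-1) ^+ (k (s a) * k (s b)).

End Unshuffles.

Section GradedSections.
Variables (R : realType) (M : manifold R) (U : set M) (E : nat -> vbundle U).

Definition gsec := forall i p, E i p.

(* x is a smooth section over V of E_{-k} *)
Definition hsec (V : set M) (k : nat) (x : gsec) :=
  smooth_section V (x k) /\ forall i, i != k -> forall p, V p -> x i p = 0.

Definition geq (V : set M) (x y : gsec) := forall i p, V p -> x i p = y i p.

Definition glin (f : M -> R) (x y : gsec) : gsec :=
  fun i p => f p *: x i p + y i p.

End GradedSections.

(* An operator on sheaves of sections is represented by one function la_brk on
   arbitrary set-theoretic graded sections: by la_local and la_degree, it
   induces on every open V `<=` U an operation on smooth homogeneous sections
   over V, compatibly with restrictions. Its value on other arguments is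
   irrelevant. The bundle morphism ac_d of the linear part is the O-linear
   unary bracket. Linearity is stated in one slot, graded symmetry extends it
   to the other ones. *)
Record lie_infty_algebroid (R : realType) (M : manifold R) (U : set M) :=
  LieInftyAlgebroid {
  la_lin :> anchored_bundles U;
  la_brk : seq (gsec la_lin) -> gsec la_lin;
  la_local : forall V n (k : 'I_n -> nat) (x y : 'I_n -> gsec la_lin),
    open V -> V `<=` U -> (0 < n)%N ->
    (forall j, hsec V (k j) (x j)) -> (forall j, hsec V (k j) (y j)) ->
    (forall j, geq V (x j) (y j)) ->
    geq V (la_brk (codom x)) (la_brk (codom y));
  la_degree : forall V n (k : 'I_n -> nat) (x : 'I_n -> gsec la_lin),
    open V -> V `<=` U -> (0 < n)%N -> (forall j, hsec V (k j) (x j)) ->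
    hsec V (\sum_j k j)%N.-1 (la_brk (codom x));
  la_sym : forall V n (k : 'I_n -> nat) (x : 'I_n -> gsec la_lin) (s : 'S_n),
    open V -> V `<=` U -> (0 < n)%N -> (forall j, hsec V (k j) (x j)) ->
    forall i p, V p ->
    la_brk (codom (fun j => x (s j))) i p
      = koszul R k s *: la_brk (codom x) i p;
  la_unary : forall V k (x : gsec la_lin), open V -> V `<=` U -> hsec V k x ->
    forall i p, V p -> la_brk [:: x] i p = ac_d la_lin i p (x i.+1 p);
  la_linear : forall V n (k : 'I_n -> nat) (z : 'I_n -> gsec la_lin)
      l (x y : gsec la_lin) f,
    open V -> V `<=` U -> n != 1%N -> smooth_on V f ->
    (forall j, hsec V (k j) (z j)) -> hsec V l x -> hsec V l y ->
    geq V (la_brk (glin f x y :: codom z))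
      (glin f (la_brk (x :: codom z)) (la_brk (y :: codom z)));
  la_leibniz : forall V k l (x y z : gsec la_lin) f,
    open V -> V `<=` U -> smooth_on V f ->
    hsec V k x -> hsec V l y -> hsec V l z ->
    forall i p, V p ->
    la_brk [:: x; glin f y z] i p =
      f p *: la_brk [:: x; y] i p
      + (if k == 1%N then (ac_rho la_lin p (x 1%N p) : (M -> R) -> R) f else 0)
          *: y i p
      + la_brk [:: x; z] i p;
  la_jacobi : forall V n (k : 'I_n -> nat) (x : 'I_n -> gsec la_lin),
    open V -> V `<=` U -> (0 < n)%N -> (forall j, hsec V (k j) (x j)) ->
    forall d p, V p ->
    \sum_(1 <= i < n.+1) \sum_(s : 'S_n | unshuffle i s)
      koszul R k s *:
        la_brk (la_brk [seq x (s j) | j : 'I_n <- enum 'I_n & (j < i)%N]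
                 :: [seq x (s j) | j : 'I_n <- enum 'I_n & (i <= j)%N]) d p = 0 }.

Definition universal (R : realType) (M : manifold R) (U : set M)
    (F : singular_foliation M) (A : lie_infty_algebroid U) :=
  geometric_resolution F A.

Section Kernel.
Variables (R : realType) (V W : lmodType R) (f : {linear V -> W}).

Definition ker_pred : {pred V} := fun x => f x == 0.

Lemma ker_submod_closed : submod_closed ker_pred.
Proof.
split; first by apply/eqP; exact: linear0.
by move=> a u v /eqP fu /eqP fv; apply/eqP; rewrite linearP fu fv scaler0 addr0.
Qed.

HB.instance Definition _ :=
  GRing.isSubmodClosed.Build R V ker_pred ker_submod_closed.

Record ker := Ker { ker_val : V; ker_valP : ker_val \in ker_pred }.

HB.instance Definition _ := [isSub for ker_val].
HB.instance Definition _ := [Choice of ker by <:].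
HB.instance Definition _ := [SubChoice_isSubLmodule of ker by <:].

End Kernel.

Section Isotropy.
Variables (R : realType) (M : manifold R) (U : set M).
Variables (A : lie_infty_algebroid U) (m : M).

(* H^{-i}(F, m) for a resolution minimal at m: the complex computing it has
   zero differential *)
Definition isoH (i : nat) : lmodType R :=
  match i with
  | 1%N => ker (ac_rho A m)
  | _ => A i m
  end.

Definition isoH_val (i : nat) : isoH i -> A i m :=
  match i return isoH i -> A i m with
  | 1%N => fun v => ker_val v
  | _ => id
  end.

(* xs is a list of local homogeneous sections over V extending vs *)
Fixpoint extends (V : set M) (xs : seq (gsec A)) (vs : seq {i & isoH i})
    : Prop :=
  match xs, vs with
  | [::], [::] => True
  | x :: xs', v :: vs' =>
      [/\ hsec V (tag v) x, x (tag v) m = isoH_val (tagged v)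
        & extends V xs' vs']
  | _, _ => False
  end.

(* extend to local sections, take the bracket, evaluate at m; v in isoH i has
   degree - i *)
Definition iso_bracket (vs : seq {i & isoH i}) : isoH (sumn (map tag vs)).-1 :=
  xget 0 [set w | exists V xs,
    [/\ open V, V `<=` U, V m, extends V xs vs
      & isoH_val w = la_brk xs (sumn (map tag vs)).-1 m]].

Definition iso_lie (x y : isoH 1) : isoH 1 :=
  iso_bracket [:: Tagged isoH x; Tagged isoH y].

Definition iso_act (x : isoH 1) (u : isoH 2) : isoH 2 :=
  iso_bracket [:: Tagged isoH x; Tagged isoH u].

(* a cochain on lists, of which only the values on lists of size 3 matter *)
Definition iso_cochain3 (s : seq (isoH 1)) : isoH 2 :=
  if s is [:: x; y; z] then
    iso_bracket [:: Tagged isoH x; Tagged isoH y; Tagged isoH z]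
  else 0.

End Isotropy.

Section Comparison.
Variables (R : realType) (M : manifold R) (U U' : set M).
Variables (m : M).

(* a morphism of resolutions near m over the identity of F, up to restriction
   of each of its components to a smaller neighbourhood of m *)
Definition comparison (C : anchored_bundles U) (C' : anchored_bundles U')
    (phi : forall i p, C i p -> C' i p) :=
  [/\ forall i, exists W, [/\ open W, W m, W `<=` U `&` U'
        & bundle_morphism W (phi i)],
      exists W, [/\ open W, W m & forall p, W p -> forall x,
        ac_rho C' p (phi 1%N p x) = ac_rho C p x]
    & forall i, exists W, [/\ open W, W m & forall p, W p -> forall x,
        phi i p (ac_d C i p x) = ac_d C' i p (phi i.+1 p x)]].

(* tau is the isomorphism induced in cohomology at m by any comparison *)
Definition canonical_iso (A : lie_infty_algebroid U)
    (A' : lie_infty_algebroid U')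
    (tau : forall i, isoH A m i -> isoH A' m i) :=
  [/\ exists phi, comparison (C := A) (C' := A') phi,
      forall phi, comparison (C := A) (C' := A') phi ->
        forall i v, isoH_val (tau i v) = phi i m (isoH_val v)
    & forall i, bijective (tau i)].

End Comparison.

Section LieAlgebra.
Variables (K : fieldType) (g : lmodType K) (br : g -> g -> g).

Definition is_lie_algebra :=
  [/\ forall a x y z, br (a *: x + y) z = a *: br x z + br y z,
      forall a x y z, br x (a *: y + z) = a *: br x y + br x z,
      forall x, br x x = 0
    & forall x y z, br x (br y z) + br y (br z x) + br z (br x y) = 0].

Variables (V : lmodType K) (act : g -> V -> V).

Definition is_lie_module :=
  [/\ forall a x y v, act (a *: x + y) v = a *: act x v + act y v,
      forall a x v w, act x (a *: v + w) = a *: act x v + act x w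
    & forall x y v, act (br x y) v = act x (act y v) - act y (act x v)].

(* k-cochains are functions on lists, considered on lists of size k only *)
Definition ce_cochain (k : nat) (w : seq g -> V) :=
  (forall s1 s2 a x y, (size s1 + size s2).+1 = k ->
     w (s1 ++ (a *: x + y) :: s2)
       = a *: w (s1 ++ x :: s2) + w (s1 ++ y :: s2)) /\
  (forall s, size s = k -> ~~ uniq s -> w s = 0).

Definition delete (i : nat) (s : seq g) := take i s ++ drop i.+1 s.

Definition ce_diff (w : seq g -> V) (s : seq g) : V :=
  \sum_(i < size s) (-1) ^+ i *: act s`_i (w (delete i s))
  + \sum_(j < size s) \sum_(i < size s | (i < j)%N)
      (-1) ^+ (i + j) *: w (br s`_i s`_j :: delete i (delete j s)).

Definition ce_cocycle (k : nat) (w : seq g -> V) :=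
  ce_cochain k w /\ forall s, size s = k.+1 -> ce_diff w s = 0.

Definition ce_cohomologous (k : nat) (w w' : seq g -> V) :=
  exists2 eta, ce_cochain k.-1 eta
    & forall s, size s = k -> w s - w' s = ce_diff eta s.

End LieAlgebra.

(* Main.v *)
Require Import Defs.
From mathcomp Require Import all_boot all_order all_algebra all_fingroup.
From mathcomp Require Import all_classical all_reals all_analysis.
From mathcomp Require Import ring.

Set Implicit Arguments.
Unset Strict Implicit.
Unset Printing Implicit Defensive.

Import Order.TTheory GRing.Theory Num.Theory.
Import numFieldNormedType.Exports.

Local Open Scope classical_set_scope.
Local Open Scope ring_scope.

(** The brackets at m are tensorial in every slot up to anchor terms, which
    vanish on the kernel of the anchor, so they can be computed with arbitrary
    local extensions; by minimality all the terms of the Jacobi identities that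
    contain the differential vanish at m, which leaves the Lie algebra, module
    and cocycle identities.

    Lifting the identity of F through the resolutions over local frames gives a
    chain map phi between two universal algebroids, unique up to homotopy, hence
    unique at m. The defect D(X, Y) = phi [X, Y] - [phi X, phi Y] is O-bilinear
    and killed by the anchor, so D = d Phi for a skew bilinear Phi. Then
    phi [X, V] - [phi X, phi V] - Phi(X, dV) and
      phi {X, Y, Z} - {phi X, phi Y, phi Z}
        - (signed cyclic sum of [phi Z, Phi(X, Y)] - Phi([X, Y], Z))
    are closed, hence locally exact, hence zero at m by minimality; the second
    identity says that the two 3-cocycles differ by the coboundary of Phi(m). *)

(** * Smooth functions *)

(** Exactness of a resolution concerns germs of sections, while the differential itself vanishes at
    m. No equation can therefore be solved inside the fibre over m: chain maps, homotopies and
    primitives are built from sections near m, turned into fibrewise maps by means of frames, and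
    evaluated at m only at the end. The neighbourhoods, which shrink at each step, are hidden in
    germ predicates. A second obstacle is that compatibility of the anchor with the binary bracket
    is not an axiom. It is extracted from the Leibniz rule and the Jacobi identity, and it serves
    twice: the kernel of the anchor at m is closed under the bracket, and the defect D lies in the
    kernel of the anchor, without which it would have no primitive. The Jacobi identities are given
    as sums over unshuffles with Koszul signs. In arities 2, 3 and 4 they are expanded by
    computation on lists of numbers, and the resulting linear identities are checked by
    reflection. *)

Section CkCalculus.
Variables (R : realType) (n : nat).
Implicit Types (W : set 'rV[R]_n) (f g : 'rV[R]_n -> R).

Lemma near_eq_continuous (T U : topologicalType) (x : T) (f g : T -> U) :
  (\near x, g x = f x) -> {for x, continuous g} -> {for x, continuous f}.
Proof.
move=> gf cg; rewrite /prop_for /continuous_at -(nbhs_singleton gf).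
by apply: cvg_trans cg; apply: near_eq_cvg.
Qed.

(** Gluing and change of representative in one statement: continuity and partial derivatives at a
    point depend only on the germ there, at every order. *)
Lemma Ck_local k W f :
  (forall x, W x -> exists W' g, [/\ open W', W' x,
     forall y, W' y -> f y = g y & Ck k W' g]) -> Ck k W f.
Proof.
have cont x (W' : set 'rV[R]_n) (f1 g : 'rV[R]_n -> R) : open W' -> W' x ->
    (forall y, W' y -> f1 y = g y) -> {for x, continuous g} ->
    {for x, continuous f1}.
  move=> oW W'x fg; apply: near_eq_continuous.
  by near=> y; rewrite fg//; near: y; apply: open_nbhs_nbhs.
elim: k W f => [|k IH] W f H.
  split=> // x /H[W' [g [oW W'x fg [/(_ _ W'x) cg _]]]].
  exact: (cont _ _ _ _ oW W'x fg cg).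
split=> [x /H[W' [g [oW W'x fg [/(_ _ W'x) cg _]]]]|i].
  exact: (cont _ _ _ _ oW W'x fg cg).
split=> [x /H[W' [g [oW W'x fg [_ /(_ i)[+ _]]]]]|].
  move=> /(_ _ W'x); apply: near_eq_derivable.
  by near=> y; rewrite fg//; near: y; apply: open_nbhs_nbhs.
apply: IH => x /H[W' [g [oW W'x fg [_ /(_ i)[_ Dg]]]]].
exists W', (fun x => 'D_(delta_mx 0 i) g x); split => // y W'y.
apply: near_eq_derive.
by near=> z; rewrite fg//; near: z; apply: open_nbhs_nbhs.
Unshelve. all: by end_near. Qed.

Lemma Ck_ext k W f g :
  open W -> (forall x, W x -> f x = g x) -> Ck k W g -> Ck k W f.
Proof. by move=> oW fg Wg; apply: Ck_local => x Wx; exists W, g. Qed.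

Lemma Ck_subset k W W' f : W' `<=` W -> Ck k W f -> Ck k W' f.
Proof.
move=> sW; elim: k f => [|k IH] f [cf df].
  by split=> // x /sW; exact: cf.
split=> [x /sW|i]; first exact: cf.
by have [di Di] := df i; split=> [x /sW|]; [exact: di|exact: IH].
Qed.

Lemma CkW k W f : Ck k.+1 W f -> Ck k W f.
Proof.
elim: k f => [|k IH] f [cf df]; first by split.
split => // i; by have [di Di] := df i; split => //; exact: IH.
Qed.

Lemma Ck_cst k W (a : R) : Ck k W (fun=> a).
Proof.
elim: k a => [|k IH] a; first by split=> // x _; exact: cst_continuous.
split=> [x _|i]; first exact: cst_continuous.
split=> [x _|]; first exact: derivable_cst.
have -> : (fun x => 'D_(delta_mx 0 i) (fun _ : 'rV[R]_n => a) x) = fun=> 0.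
  by apply/funext => x; exact: derive_cst.
exact: IH.
Qed.

Lemma CkD k W f g :
  open W -> Ck k W f -> Ck k W g -> Ck k W (fun x => f x + g x).
Proof.
move=> oW; elim: k f g => [|k IH] f g [cf df] [cg dg].
  by split=> // x Wx; apply: continuousD; [exact: cf|exact: cg].
split=> [x Wx|i]; first by apply: continuousD; [exact: cf|exact: cg].
have [di Di] := df i; have [ei Ei] := dg i; split=> [x Wx|].
  by apply: derivableD; [exact: di|exact: ei].
apply: Ck_ext (IH _ _ Di Ei) => // x Wx /=.
by apply: deriveD; [exact: di|exact: ei].
Qed.

Lemma CkM k W f g :
  open W -> Ck k W f -> Ck k W g -> Ck k W (fun x => f x * g x).
Proof.
move=> oW; elim: k f g => [|k IH] f g Cf Cg; have [cf df] := Cf;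
  have [cg dg] := Cg.
  by split=> // x Wx; apply: continuousM; [exact: cf|exact: cg].
split=> [x Wx|i]; first by apply: continuousM; [exact: cf|exact: cg].
have [di Di] := df i; have [ei Ei] := dg i; split=> [x Wx|].
  by apply: derivableM; [exact: di|exact: ei].
apply: (@Ck_ext k W _ (fun x => f x * 'D_(delta_mx 0 i) g x
  + g x * 'D_(delta_mx 0 i) f x)) => // [x Wx /=|].
  by apply: deriveM; [exact: di|exact: ei].
by apply: CkD => //; apply: IH => //; exact: CkW.
Qed.

End CkCalculus.

Section SmoothFunctions.
Variables (R : realType) (M : manifold R).
Implicit Types (V W : set M) (f g : M -> R) (p q : M).

(** The image is the open chart image intersected with the preimage of V under the inverse chart,
    which is continuous there. *)
Lemma chart_image_open (c : chart R (mdim M) M) V :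
  open V -> open (chart_map c @` (chart_dom c `&` V)).
Proof.
move=> oV; have oc : open (chart_map c @` chart_dom c) by exact: chart_img_open.
have -> : chart_map c @` (chart_dom c `&` V) =
    (chart_map c @` chart_dom c) `&` chart_inv c @^-1` V.
  apply/seteqP; split=> [_ [p [cp Vp] <-]|_ [[p cp <-]]] /=.
    by split; [exists p|rewrite /= chart_mapK].
  by rewrite /= chart_mapK// => Vp; exists p.
have cc : {within chart_map c @` chart_dom c, continuous (chart_inv c)}.
  by move=> x; exact: chart_inv_cont.
move: cc; rewrite continuous_open_subspace// => cc.
rewrite openE => y [cy Vy]; apply: filterI; first exact: open_nbhs_nbhs.
by apply: cc; [rewrite inE|exact: open_nbhs_nbhs].
Qed.

Lemma smooth_on_subset V W f : W `<=` V -> smooth_on V f -> smooth_on W f.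
Proof.
move=> WV sf c ac k; apply: Ck_subset (sf c ac k).
by apply: image_subset => p [cp Wp]; split => //; exact: WV.
Qed.

Lemma smooth_on_local V f :
  open V -> (forall p, V p -> smooth_at p f) -> smooth_on V f.
Proof.
move=> oV H c ac k; apply: Ck_local => _ [p [cp Vp] <-].
have [W [oW Wp sf]] := H _ Vp.
exists (chart_map c @` (chart_dom c `&` W)), (f \o chart_inv c); split => //.
- exact: chart_image_open.
- by exists p.
- exact: sf.
Qed.

Lemma smooth_on_at V p f : open V -> V p -> smooth_on V f -> smooth_at p f.
Proof. by move=> oV Vp sf; exists V. Qed.

Lemma smooth_at_near p f : smooth_at p f -> \near p, smooth_at p f.
Proof.
move=> [V [oV Vp sf]]; near=> q; exists V; split => //.
by near: q; exact: open_nbhs_nbhs.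
Unshelve. all: by end_near. Qed.

Lemma near_open (p : M) (P : M -> Prop) :
  (\near p, P p) -> exists V, [/\ open V, V p & forall q, V q -> P q].
Proof.
move=> nP; have : nbhs p P by exact: nP.
by rewrite nbhsE => -[V [oV Vp] VP]; exists V.
Qed.

Lemma smooth_at_eq p f g :
  (\near p, f p = g p) -> smooth_at p g -> smooth_at p f.
Proof.
move=> /near_open[W [oW Wp fg]] [V [oV Vp sg]].
exists (W `&` V); split; [exact: openI|by []|].
move=> c ac k; have WVo := @chart_image_open c _ (openI oW oV).
apply: (@Ck_ext _ _ _ _ _ (g \o chart_inv c)) => //.
  by move=> _ [q [cq [Wq Vq]] <-] /=; rewrite chart_mapK// fg.
exact: (smooth_on_subset (@subIsetr _ W V) sg).
Qed.

Lemma smooth_at_cst p (a : R) : smooth_at p (fun=> a).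
Proof.
exists setT; split => //; first exact: openT.
by move=> c ac k; exact: Ck_cst.
Qed.

Lemma smooth_atD p f g :
  smooth_at p f -> smooth_at p g -> smooth_at p (fun q => f q + g q).
Proof.
move=> [V [oV Vp sf]] [W [oW Wp sg]]; exists (V `&` W); split => //.
  exact: openI.
move=> c ac k; apply: (CkD (f := f \o chart_inv c) (g := g \o chart_inv c)).
- exact/chart_image_open/openI.
- exact: (smooth_on_subset (@subIsetl _ V W) sf).
- exact: (smooth_on_subset (@subIsetr _ V W) sg).
Qed.

Lemma smooth_atM p f g :
  smooth_at p f -> smooth_at p g -> smooth_at p (fun q => f q * g q).
Proof.
move=> [V [oV Vp sf]] [W [oW Wp sg]]; exists (V `&` W); split => //.
  exact: openI.
move=> c ac k; apply: (CkM (f := f \o chart_inv c) (g := g \o chart_inv c)).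
- exact/chart_image_open/openI.
- exact: (smooth_on_subset (@subIsetl _ V W) sf).
- exact: (smooth_on_subset (@subIsetr _ V W) sg).
Qed.

Lemma near_bump (p : M) (P : M -> Prop) :
  (\near p, P p) -> \near p, \near p, P p.
Proof.
move=> /near_open[V [oV Vp VP]]; near=> q.
have Vq : V q by near: q; exact: open_nbhs_nbhs.
by near=> r; apply: VP; near: r; exact: open_nbhs_nbhs.
Unshelve. all: by end_near. Qed.

End SmoothFunctions.

(** * Germs of sections and local frames *)

Section SectionGerms.
Variables (R : realType) (M : manifold R) (U : set M) (E : vbundle U).
Implicit Types (V W : set M) (p q m : M) (s t : forall q, E q).

(** Smoothness near p with the neighbourhood hidden, so that repeated restrictions need no
    bookkeeping. *)
Definition section_at p s := exists V, [/\ open V, V p & smooth_section V s].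

Lemma section_at_near p s : section_at p s -> \near p, section_at p s.
Proof.
move=> [V [oV Vp ss]]; near=> q; exists V; split => //.
by near: q; exact: open_nbhs_nbhs.
Unshelve. all: by end_near. Qed.

Lemma section_at_coord p s (c : trivialization E) j :
  section_at p s -> vb_atlas c -> triv_dom c p ->
  smooth_at p (fun q => triv_map c q (s q) 0 j).
Proof.
move=> [V [oV Vp ss]] ac cp.
apply: (smooth_on_at (V := V `&` triv_dom c)) => //.
  exact: openI oV (triv_dom_open c).
exact: ss.
Qed.

Lemma smooth_section_local V s :
  open V -> (forall p, V p -> section_at p s) -> smooth_section V s.
Proof.
move=> oV H t at_ j; apply: smooth_on_local.
  exact: openI oV (triv_dom_open t).
by move=> p [Vp tp]; apply: section_at_coord => //; exact: H.
Qed.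

Lemma section_atP p s : (\forall q \near p, forall c : trivialization E,
    vb_atlas c -> triv_dom c q ->
    forall j, smooth_at q (fun q => triv_map c q (s q) 0 j)) ->
  section_at p s.
Proof.
move=> /near_open[V [oV Vp H]]; exists V; split => // t at_ j.
apply: smooth_on_local; first exact: openI oV (triv_dom_open t).
by move=> q [Vq tq]; exact: H.
Qed.

Lemma section_at_lin p f s t : smooth_at p f -> section_at p s ->
  section_at p t -> section_at p (fun q => f q *: s q + t q).
Proof.
move=> /smooth_at_near sf /section_at_near gs /section_at_near gt.
apply: section_atP; near=> q => c ac cq j.
have -> : (fun q => triv_map c q (f q *: s q + t q) 0 j) =
    fun q => f q * triv_map c q (s q) 0 j + triv_map c q (t q) 0 j.
  by apply: functional_extensionality_dep => r; rewrite linearP !mxE.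
apply: smooth_atD; last by apply: section_at_coord => //; near: q.
apply: smooth_atM; first by near: q.
by apply: section_at_coord => //; near: q.
Unshelve. all: by end_near. Qed.

Lemma section_at0 p : section_at p (fun q => 0 : E q).
Proof.
apply: section_atP; near=> q => c ac cq j.
have -> : (fun q => triv_map c q 0 0 j) = fun=> 0.
  by apply: functional_extensionality_dep => r; rewrite linear0 mxE.
exact: smooth_at_cst.
Unshelve. all: by end_near. Qed.

Lemma section_atD p s t : section_at p s -> section_at p t ->
  section_at p (fun q => s q + t q).
Proof.
move=> gs gt; have := section_at_lin (smooth_at_cst p 1) gs gt.
by congr section_at; apply: functional_extensionality_dep => q; rewrite scale1r.
Qed.

Lemma section_atZ p f s : smooth_at p f -> section_at p s ->
  section_at p (fun q => f q *: s q).
Proof.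
move=> sf gs; have := section_at_lin sf gs (section_at0 p).
by congr section_at; apply: functional_extensionality_dep => q; rewrite addr0.
Qed.

Lemma section_atN p s : section_at p s -> section_at p (fun q => - s q).
Proof.
move=> gs; have := section_atZ (smooth_at_cst p (-1)) gs.
by congr section_at; apply: functional_extensionality_dep => q; rewrite scaleN1r.
Qed.

Lemma section_atB p s t : section_at p s -> section_at p t ->
  section_at p (fun q => s q - t q).
Proof. by move=> gs gt; apply: section_atD => //; exact: section_atN. Qed.

Lemma section_at_sum p (I : Type) (r : seq I) (f : I -> M -> R)
    (s : I -> forall q, E q) :
  (forall i, smooth_at p (f i)) -> (forall i, section_at p (s i)) ->
  section_at p (fun q => \sum_(i <- r) f i q *: s i q).
Proof.
move=> sf gs; elim: r => [|i r IH].
  have := section_at0 p; congr section_at.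
  apply: functional_extensionality_dep => q.
  by rewrite big_nil.
have := section_at_lin (sf i) (gs i) IH; congr section_at.
by apply: functional_extensionality_dep => q; rewrite big_cons.
Qed.

(** A trivialization seen from the side of sections. The coordinates are linear forms on the fibres,
    so that data prescribed on the frame vectors extend to fibrewise maps. *)
Record frame W := Frame {
  fr_rank : nat;
  fr_vec : 'I_fr_rank -> forall q, E q;
  fr_coef : 'I_fr_rank -> forall q, E q -> R;
  fr_open : open W;
  fr_sub : W `<=` U;
  fr_vec_at : forall j q, W q -> section_at q (fr_vec j);
  fr_coef_lin : forall j q, W q -> forall a x y,
    fr_coef j (a *: x + y : E q) = a * fr_coef j x + fr_coef j y;
  fr_coef_at : forall j q s, W q -> section_at q s ->
    smooth_at q (fun q => fr_coef j (s q));
  fr_dec : forall q (x : E q), W q -> x = \sum_j fr_coef j x *: fr_vec j q }.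

Arguments fr_vec {W} f j q : rename.
Arguments fr_coef {W} f j {q} x : rename.
Arguments fr_vec_at {W} f j {q} Wq : rename.
Arguments fr_coef_lin {W} f j {q} Wq a x y : rename.
Arguments fr_coef_at {W} f j {q s} Wq gs : rename.
Arguments fr_dec {W} f {q} x Wq : rename.

Lemma frame_exists m : U m -> exists W, W m /\ inhabited (frame W).
Proof.
move=> /(@vb_cover _ _ _ E)[t at_ tm]; exists (triv_dom t).
split => //; constructor.
apply: (@Frame (triv_dom t) _
  (fun j q => triv_inv t q (delta_mx 0 j)) (fun j q x => triv_map t q x 0 j)).
- exact: triv_dom_open.
- exact: vb_sub.
- move=> j q tq; exists (triv_dom t); split => //; first exact: triv_dom_open.
  by move=> t' at' k; exact: vb_compat.
- by move=> j q _ a x y; rewrite linearP !mxE.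
- by move=> j q s tq gs; exact: section_at_coord.
- move=> q x tq; apply: (can_inj (triv_mapK tq)).
  rewrite linear_sum [LHS]row_sum_delta; apply: eq_bigr => j _.
  by rewrite linearZ triv_invK.
Qed.

(** [V] stands for a fibre over q, hence f acts through its value [f q]. The first clause says that
    only the germ of the section matters, which allows expansions valid near q only. *)
Definition tensorial_at q (V : lmodType R) (B : (forall p, E p) -> V) :=
  (forall s t, section_at q s -> section_at q t -> (\near q, s q = t q) ->
     B s = B t) /\
  (forall f s t, smooth_at q f -> section_at q s -> section_at q t ->
     B (fun p => f p *: s p + t p) = f q *: B s + B t).

Lemma tensorial_frame W (b : frame W) q (V : lmodType R)
    (B : (forall p, E p) -> V) s :
  W q -> tensorial_at q B -> section_at q s ->
  B s = \sum_j fr_coef b j (s q) *: B (fr_vec b j).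
Proof.
move=> Wq [Beq Blin] gs.
have B0 : B (fun p => 0) = 0.
  have := Blin _ _ _ (smooth_at_cst q 1) (section_at0 q) (section_at0 q).
  rewrite scale1r; set u := B _; set v := B _.
  have -> : u = v.
    congr B; apply: functional_extensionality_dep => p.
    by rewrite scaler0 addr0.
  by move/(congr1 (fun x => x - v)); rewrite addrK subrr.
have cs j := fr_coef_at b j Wq gs.
have es j := fr_vec_at b j Wq.
have oW := fr_open b.
rewrite (Beq s (fun p => \sum_j fr_coef b j (s p) *: fr_vec b j p)) //.
- elim: (index_enum _) => [|i r IH].
    rewrite big_nil -[RHS]B0; congr B.
    by apply: functional_extensionality_dep => p; rewrite big_nil.
  rewrite big_cons -IH -(Blin (fun p => fr_coef b i (s p))) //;
    last exact: section_at_sum.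
  by congr B; apply: functional_extensionality_dep => p; rewrite big_cons.
- exact: section_at_sum.
- near=> p; apply: fr_dec; near: p; exact: open_nbhs_nbhs.
Unshelve. all: by end_near. Qed.

Lemma tensorial_eq q (V : lmodType R) (B : (forall p, E p) -> V) s t :
  U q -> tensorial_at q B -> section_at q s -> section_at q t -> s q = t q ->
  B s = B t.
Proof.
move=> /frame_exists[W [Wq [b]]] tB gs gt st.
by rewrite (tensorial_frame b Wq tB gs) (tensorial_frame b Wq tB gt) st.
Qed.

(** A combination of frame vectors with constant coefficients extends x. *)
Lemma section_extension q (x : E q) : U q -> exists2 s, section_at q s & s q = x.
Proof.
move=> /frame_exists[W [Wq [b]]].
exists (fun p => \sum_j fr_coef b j x *: fr_vec b j p).
  apply: (@section_at_sum q _ _ (fun j _ => fr_coef b j x)) => j.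
    exact: smooth_at_cst.
  exact: fr_vec_at.
by rewrite /= -fr_dec.
Qed.

End SectionGerms.

Arguments fr_vec {R M U E W} f j q : rename.
Arguments fr_coef {R M U E W} f j {q} x : rename.
Arguments fr_vec_at {R M U E W} f j {q} Wq : rename.
Arguments fr_coef_lin {R M U E W} f j {q} Wq a x y : rename.
Arguments fr_coef_at {R M U E W} f j {q s} Wq gs : rename.
Arguments fr_dec {R M U E W} f {q} x Wq : rename.

Section BundleMorphismGerms.
Variables (R : realType) (M : manifold R).

(** This is literally the first clause of [comparison], so the components of a comparison are such
    germs by definition. *)
Definition morphism_at (U U' : set M) (E : vbundle U) (E' : vbundle U') (m : M)
    (phi : forall p, E p -> E' p) :=
  exists W, [/\ open W, W m, W `<=` U `&` U' & bundle_morphism W phi].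

Lemma bundle_morphismP (U U' : set M) (E : vbundle U) (E' : vbundle U')
    (W : set M) (phi : forall p, E p -> E' p) :
  (forall p, W p -> forall a x y,
     phi p (a *: x + y) = a *: phi p x + phi p y) ->
  (forall p s, W p -> section_at p s -> section_at p (fun q => phi q (s q))) ->
  bundle_morphism W phi.
Proof.
move=> lin sec; split => // V s oV VW ss; apply: smooth_section_local => // p Vp.
by apply: sec; [exact: VW|exists V].
Qed.

Section Germ.
Variables (U U' : set M) (E : vbundle U) (E' : vbundle U') (m : M).
Implicit Type phi : forall p, E p -> E' p.

Lemma morphism_at_near phi : morphism_at m phi -> \near m, morphism_at m phi.
Proof.
move=> [W [oW Wm WU bW]]; near=> q; exists W; split => //.
by near: q; exact: open_nbhs_nbhs.
Unshelve. all: by end_near. Qed.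

Lemma morphism_at_lin phi : morphism_at m phi ->
  forall a x y, phi m (a *: x + y) = a *: phi m x + phi m y.
Proof. by move=> [W [_ Wm _ [lin _]]]; exact: lin. Qed.

Lemma morphism_atD phi x y : morphism_at m phi ->
  phi m (x + y) = phi m x + phi m y.
Proof. by move=> /morphism_at_lin/(_ 1 x y); rewrite !scale1r. Qed.

Lemma morphism_at0 phi : morphism_at m phi -> phi m 0 = 0.
Proof.
move=> /(morphism_atD 0 0); rewrite addr0.
by move/(congr1 (fun x => x - phi m 0)); rewrite addrK subrr.
Qed.

Lemma morphism_atZ phi a x : morphism_at m phi -> phi m (a *: x) = a *: phi m x.
Proof.
move=> pm; have := morphism_at_lin pm a x 0.
by rewrite (morphism_at0 pm) !addr0.
Qed.

Lemma morphism_atN phi x : morphism_at m phi -> phi m (- x) = - phi m x.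
Proof. by move=> pm; rewrite -[- x]scaleN1r morphism_atZ// scaleN1r. Qed.

Lemma morphism_atB phi x y : morphism_at m phi ->
  phi m (x - y) = phi m x - phi m y.
Proof. by move=> pm; rewrite morphism_atD// morphism_atN. Qed.

Lemma morphism_at_section phi s : morphism_at m phi -> section_at m s ->
  section_at m (fun q => phi q (s q)).
Proof.
move=> [W [oW Wm _ [_ bW]]] [V [oV Vm ss]]; exists (W `&` V).
split => //; first exact: openI.
apply: bW; [exact: openI|exact: subIsetl|].
move=> t at_ j; apply: smooth_on_subset (ss _ at_ j).
by move=> p [[_ Vp] tp].
Qed.

End Germ.

Lemma morphism_at_id (U : set M) (E : vbundle U) m : open U -> U m ->
  morphism_at (E := E) (E' := E) m (fun p => id).
Proof. by move=> oU Um; exists U; split => //; move=> p. Qed.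

Lemma morphism_at_comp (U1 U2 U3 : set M) (E1 : vbundle U1) (E2 : vbundle U2)
    (E3 : vbundle U3) m (phi : forall p, E1 p -> E2 p)
    (psi : forall p, E2 p -> E3 p) :
  morphism_at m phi -> morphism_at m psi ->
  morphism_at m (fun p => psi p \o phi p).
Proof.
move=> [W [oW Wm WU bW]] [W' [oW' Wm' WU' bW']].
exists (W `&` W'); split => //; first exact: openI.
  by move=> p [/WU[? _] /WU'[_ ?]].
apply: bundle_morphismP => p.
- by move=> [Wp Wp'] a x y /=; rewrite bW.1// bW'.1.
- move=> s [Wp Wp'] gs.
  apply: (@morphism_at_section _ _ _ _ _ psi (fun q => phi q (s q))).
    by exists W'.
  by apply: morphism_at_section gs; exists W.
Qed.

Lemma morphism_at_sub (U1 U2 : set M) (E1 : vbundle U1) (E2 : vbundle U2) m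
    (phi psi : forall p, E1 p -> E2 p) :
  morphism_at m phi -> morphism_at m psi ->
  morphism_at m (fun p x => phi p x - psi p x).
Proof.
move=> [W [oW Wm WU bW]] [W' [oW' Wm' WU' bW']].
exists (W `&` W'); split => //; first exact: openI.
  by move=> p [/WU].
apply: bundle_morphismP => p.
- move=> [Wp Wp'] a x y /=; rewrite bW.1// bW'.1// scalerBr.
  by rewrite opprD addrACA.
- move=> s [Wp Wp'] gs; apply: section_atB.
  + by apply: morphism_at_section gs; exists W.
  + by apply: morphism_at_section gs; exists W'.
Qed.

(* Over a frame, a fibrewise map is lifted through g by lifting the images of
   the frame vectors. *)
Lemma morphism_lift (U U' : set M) (E : vbundle U) (G : vbundle U')
    (T : M -> lmodType R) (f : forall q, E q -> T q)
    (g : forall q, {linear G q -> T q}) m :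
  U m -> open U' -> U' m ->
  (\forall q \near m, forall a x y, f q (a *: x + y) = a *: f q x + f q y) ->
  (forall s, section_at m s ->
     exists2 t, section_at m t & \near m, g m (t m) = f m (s m)) ->
  exists2 h : forall q, E q -> G q, morphism_at m h &
    \forall q \near m, forall x, g q (h q x) = f q x.
Proof.
move=> Um oU' Um' flin lift; have [W [Wm [b]]] := frame_exists E Um.
have oW := fr_open b.
have /boolp.choice[t gt] : forall j, exists t : forall q, G q,
    section_at m t /\ \near m, g m (t m) = f m (fr_vec b j m).
  by move=> j; have [t gt tf] := lift _ (fr_vec_at b j Wm); exists t.
have gt1 : \forall q \near m, forall j, section_at q (t j).
  by apply: filter_forall => j; apply: section_at_near; exact: (gt j).1.
have gt2 : \forall q \near m, forall j, g q (t j q) = f q (fr_vec b j q).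
  by apply: filter_forall => j; exact: (gt j).2.
have /near_open[V [oV Vm VP]] : \forall q \near m, [/\ W q, U' q,
    forall j, section_at q (t j),
    forall j, g q (t j q) = f q (fr_vec b j q) &
    forall a x y, f q (a *: x + y) = a *: f q x + f q y].
  near=> q; split; near: q => //; exact: open_nbhs_nbhs.
exists (fun q x => \sum_j fr_coef b j x *: t j q).
- exists V; split => //; first by move=> q /VP[/(fr_sub b)].
  apply: bundle_morphismP => q.
  + move=> /VP[Wq _ _ _ _] a x y; rewrite scaler_sumr -big_split /=.
    by apply: eq_bigr => j _; rewrite fr_coef_lin// scalerDl scalerA.
  + move=> s /VP[Wq _ gtq _ _] gs.
    by apply: section_at_sum => // j; exact: fr_coef_at.
- near=> q; have /VP[Wq _ _ gf fl] : V q by near: q; exact: open_nbhs_nbhs.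
  move=> x; rewrite [in RHS](fr_dec b x Wq) linear_sum.
  have f0 : f q 0 = 0.
    have := fl 1 0 0; rewrite scaler0 addr0 scale1r.
    by move/(congr1 (fun x => x - f q 0)); rewrite addrK subrr.
  elim/big_rec2: _ => // j u v _ ->.
  by rewrite linearZ /= gf fl.
Unshelve. all: by end_near. Qed.

End BundleMorphismGerms.

(** * The Jacobi identities of low arity *)

Section PermutationLists.
Variable n : nat.

(** Sums over permutations are transferred to sums over lists of numbers, which [vm_compute] can
    enumerate. *)
Definition perm_list (s : 'S_n) : seq nat := [seq val (s j) | j <- enum 'I_n].

Lemma nth_perm_list (s : 'S_n) (j : 'I_n) : nth 0%N (perm_list s) j = s j.
Proof. by rewrite (nth_map j) ?size_enum_ord// nth_ord_enum. Qed.

Lemma perm_list_inj : injective perm_list.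
Proof.
move=> s t st; apply/permP => j; apply: val_inj.
by rewrite /= -!nth_perm_list st.
Qed.

Lemma perm_list_perm (s : 'S_n) : perm_list s \in permutations (iota 0 n).
Proof.
rewrite mem_permutations -val_enum_ord /perm_list map_comp; apply: perm_map.
apply: uniq_perm; rewrite ?(map_inj_uniq (@perm_inj _ s)) ?enum_uniq// => j.
by rewrite mem_enum; apply/mapP; exists (s^-1 j)%g; rewrite ?mem_enum ?permKV.
Qed.

(** Counting: the map is injective into the permutations of [iota 0 n], and both lists have n!
    elements. *)
Lemma mem_perm_list :
  [seq perm_list s | s <- index_enum 'S_n] =i permutations (iota 0 n).
Proof.
apply: (uniq_min_size _ _ _).2.
- by rewrite (map_inj_uniq perm_list_inj) index_enum_uniq.
- by move=> _ /mapP[s _ ->]; exact: perm_list_perm.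
- rewrite size_map size_permutations ?iota_uniq// size_iota.
  by rewrite [index_enum _]unlock -enumT -cardE card_Sn.
Qed.

Lemma sum_perm_list (V : nmodType) (P : pred (seq nat)) (G : seq nat -> V) :
  \sum_(s : 'S_n | P (perm_list s)) G (perm_list s)
    = \sum_(l <- permutations (iota 0 n) | P l) G l.
Proof.
rewrite -(big_map perm_list P G); apply: perm_big.
apply: uniq_perm; rewrite ?permutations_uniq//; last exact: mem_perm_list.
by rewrite (map_inj_uniq perm_list_inj) index_enum_uniq.
Qed.

(** The exponent of the Koszul sign is kept as a natural number, so that it can be evaluated without
    computing in [R]. *)
Definition koszul_exp (ks l : seq nat) : nat :=
  sumn [seq sumn [seq nth 0 ks (nth 0 l a) * nth 0 ks (nth 0 l b)
    | b <- iota 0 n & (a < b) && (nth 0 l b < nth 0 l a)] | a <- iota 0 n]%N.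

Lemma koszulE (R : realType) (ks : seq nat) (s : 'S_n) :
  koszul R (fun j => nth 0%N ks j) s = (-1) ^+ koszul_exp ks (perm_list s).
Proof.
have iotaE : iota 0 n = index_iota 0 n by rewrite /index_iota subn0.
rewrite /koszul /koszul_exp sumnE big_map iotaE big_mkord expr_sum.
apply: eq_bigr => a _.
rewrite sumnE big_map big_filter big_mkord.
rewrite expr_sum; apply: eq_big => [b|b _]; by rewrite !nth_perm_list.
Qed.

Definition is_unshuffle (i : nat) (l : seq nat) : bool :=
  all (fun a => all (fun b => [&& a < b & (b < i) || (i <= a)] ==>
    (nth 0 l a < nth 0 l b))%N (iota 0 n)) (iota 0 n).

Lemma unshuffleE i (s : 'S_n) : unshuffle i s = is_unshuffle i (perm_list s).
Proof.
apply/forallP/allP => H.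
- move=> a; rewrite mem_iota /= add0n => an; apply/allP => b.
  rewrite mem_iota /= add0n => bn; move/forallP/(_ (Ordinal bn)): (H (Ordinal an)).
  by rewrite -!nth_perm_list.
- move=> a; apply/forallP => b.
  have ai : val a \in iota 0 n by rewrite mem_iota /= add0n.
  have bi : val b \in iota 0 n by rewrite mem_iota /= add0n.
  by have /allP/(_ _ bi) := H _ ai; rewrite !nth_perm_list.
Qed.

Lemma map_take_perm_list (T : Type) (x : nat -> T) (s : 'S_n) i :
  [seq x (s j) | j : 'I_n <- enum 'I_n & (j < i)%N]
    = [seq x a | a <- take i (perm_list s)].
Proof.
rewrite -map_take -map_comp takeEmask mask_enum_ord; congr map.
by apply: eq_filter => j; rewrite nth_nseq; case: ltnP.
Qed.

Lemma map_drop_perm_list (T : Type) (x : nat -> T) (s : 'S_n) i :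
  [seq x (s j) | j : 'I_n <- enum 'I_n & (i <= j)%N]
    = [seq x a | a <- drop i (perm_list s)].
Proof.
rewrite -map_drop -map_comp dropEmask mask_enum_ord; congr map.
apply: eq_filter => j; rewrite nth_cat size_nseq !nth_nseq size_enum_ord.
have jn : (val j < n)%N := ltn_ord j; rewrite leqNgt.
by case: (ltnP (val j) i) => ij //=; rewrite ltn_sub2r// (leq_ltn_trans ij).
Qed.

End PermutationLists.

Section BracketLists.
Variables (R : realType) (M : manifold R) (U : set M).
Variable A : lie_infty_algebroid U.
Implicit Types (V : set M) (x y z : gsec A) (xs : seq (gsec A)) (ks : seq nat).

Definition gsec0 : gsec A := fun i p => 0.

(** List form of the families indexed by ordinals in the axioms of an algebroid, suited to
    explicitly written arguments. *)
Fixpoint hsecs V (ks : seq nat) xs : Prop :=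
  match ks, xs with
  | [::], [::] => True
  | k :: ks', x :: xs' => hsec V k x /\ hsecs V ks' xs'
  | _, _ => False
  end.

Lemma hsecs_size V ks xs : hsecs V ks xs -> size ks = size xs.
Proof. by elim: ks xs => [|k ks IH] [|x xs] //= [_ /IH ->]. Qed.

Lemma hsecs_nth V ks xs j : hsecs V ks xs -> (j < size xs)%N ->
  hsec V (nth 0%N ks j) (nth gsec0 xs j).
Proof.
by elim: ks xs j => [|k ks IH] [|x xs] // [|j] //= [hx hxs] // jn; exact: IH.
Qed.

Lemma codom_nth (T : Type) (x0 : T) (xs : seq T) :
  codom (fun j : 'I_(size xs) => nth x0 xs j) = xs.
Proof.
rewrite /codom /image_mem -[RHS](mkseq_nth x0) /mkseq -val_enum_ord -map_comp.
by congr map; apply/all_filterP/allP.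
Qed.

Lemma brk_local V ks xs ys : open V -> V `<=` U -> (0 < size xs)%N ->
  hsecs V ks xs -> hsecs V ks ys ->
  (forall j, Defs.geq V (nth gsec0 xs j) (nth gsec0 ys j)) ->
  Defs.geq V (la_brk xs) (la_brk ys).
Proof.
move=> oV VU s0 hx hy e.
have sxy : size ys = size xs by rewrite -(hsecs_size hx) -(hsecs_size hy).
have := @la_local _ _ _ A V (size xs) (fun j => nth 0%N ks j)
  (fun j => nth gsec0 xs j) (fun j => nth gsec0 ys j) oV VU s0.
have -> : codom (fun j : 'I_(size xs) => nth gsec0 ys j) = ys.
  by move: (codom_nth gsec0 ys); rewrite sxy.
rewrite codom_nth; apply => // j; apply: hsecs_nth => //.
by rewrite sxy.
Qed.

Lemma brk_degree V ks xs : open V -> V `<=` U -> (0 < size xs)%N ->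
  hsecs V ks xs -> hsec V (sumn ks).-1 (la_brk xs).
Proof.
move=> oV VU s0 hx.
have := @la_degree _ _ _ A V (size xs) (fun j => nth 0%N ks j)
  (fun j => nth gsec0 xs j) oV VU s0 (fun j => hsecs_nth hx (ltn_ord j)).
rewrite codom_nth sumnE (big_nth 0%N) big_mkord (hsecs_size hx); exact.
Qed.

Lemma brk_sym V ks xs l i p : open V -> V `<=` U -> (0 < size xs)%N ->
  hsecs V ks xs -> l \in permutations (iota 0 (size xs)) -> V p ->
  la_brk [seq nth gsec0 xs a | a <- l] i p
    = (-1) ^+ koszul_exp (size xs) ks l *: la_brk xs i p.
Proof.
move=> oV VU s0 hx; rewrite -mem_perm_list => /mapP[s _ ->] Vp.
have := @la_sym _ _ _ A V (size xs) (fun j => nth 0%N ks j)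
  (fun j => nth gsec0 xs j) s oV VU s0 (fun j => hsecs_nth hx (ltn_ord j)) i p Vp.
rewrite codom_nth koszulE => <-; congr (la_brk _ i p).
rewrite /codom /image_mem -map_comp; by [].
Qed.

Lemma brk_jacobi V ks xs d p : open V -> V `<=` U -> (0 < size xs)%N ->
  hsecs V ks xs -> V p ->
  \sum_(1 <= i < (size xs).+1)
    \sum_(l <- permutations (iota 0 (size xs)) | is_unshuffle (size xs) i l)
      (-1) ^+ koszul_exp (size xs) ks l *:
        la_brk (la_brk [seq nth gsec0 xs a | a <- take i l]
                :: [seq nth gsec0 xs a | a <- drop i l]) d p = 0.
Proof.
move=> oV VU s0 hx Vp.
have := @la_jacobi _ _ _ A V (size xs) (fun j => nth 0%N ks j)
  (fun j => nth gsec0 xs j) oV VU s0 (fun j => hsecs_nth hx (ltn_ord j)) d p Vp.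
move=> J; rewrite -[RHS]J; apply: eq_bigr => i _; rewrite -sum_perm_list.
apply: eq_big => [s|s _]; first by rewrite unshuffleE.
rewrite koszulE; congr (_ *: la_brk (la_brk _ :: _) d p).
- by rewrite (map_take_perm_list (nth gsec0 xs)).
- by rewrite (map_drop_perm_list (nth gsec0 xs)).
Qed.

End BracketLists.

(** * Linear identities in modules by reflection *)

Section ModuleNormalForm.
Variables (R : comNzRingType) (V : lmodType R).

Inductive mexp :=
  | MVar of nat | MZero | MAdd of mexp & mexp | MOpp of mexp
  | MScale of R & mexp.

Fixpoint meval (env : seq V) (t : mexp) : V :=
  match t with
  | MVar i => env`_i
  | MZero => 0
  | MAdd t1 t2 => meval env t1 + meval env t2
  | MOpp t1 => - meval env t1
  | MScale a t1 => a *: meval env t1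
  end.

(** The test is [eqn], which [cbn] reduces on numerals; what remains are scalar identities for
    [ring]. *)
Fixpoint mcoef (t : mexp) (i : nat) : R :=
  match t with
  | MVar j => if eqn j i then 1 else 0
  | MZero => 0
  | MAdd t1 t2 => mcoef t1 i + mcoef t2 i
  | MOpp t1 => - mcoef t1 i
  | MScale a t1 => a * mcoef t1 i
  end.

Lemma meval_coef env t :
  meval env t = \sum_(i < size env) mcoef t i *: env`_i.
Proof.
have eqnn i j : eqn i j = (i == j) by [].
elim: t => [j||t IH u IHu|t IH|a t IH] /=.
- have [js|js] := ltnP j (size env).
    rewrite (bigD1 (Ordinal js)) //= eqnn eqxx scale1r big1 ?addr0// => i.
    rewrite -val_eqE /= => ij; rewrite eqnn eq_sym (negbTE ij).
    by rewrite scale0r.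
  rewrite nth_default// big1// => i _; rewrite eqnn gtn_eqF ?scale0r//.
  exact: leq_trans (ltn_ord i) js.
- by rewrite big1// => i _; rewrite scale0r.
- by rewrite IH IHu -big_split; apply: eq_bigr => i _; rewrite scalerDl.
- by rewrite IH -sumrN; apply: eq_bigr => i _; rewrite scaleNr.
- by rewrite IH scaler_sumr; apply: eq_bigr => i _; rewrite scalerA.
Qed.

Fixpoint mcoef_eq (t u : mexp) (n : nat) : Prop :=
  if n is n'.+1 then mcoef t n' = mcoef u n' /\ mcoef_eq t u n' else True.

Lemma meval_eq env t u : mcoef_eq t u (size env) -> meval env t = meval env u.
Proof.
move=> H; rewrite !meval_coef; apply: eq_bigr => i _; congr (_ *: _).
elim: (size env) (val i) (ltn_ord i) H => // n IH j.
by rewrite ltnS leq_eqVlt => /orP[/eqP ->|jn] [e ?] //; exact: IH.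
Qed.

End ModuleNormalForm.

Ltac mod_index a env :=
  lazymatch env with
  | ?b :: ?env' =>
    match constr:(tt) with
    | _ => let _ := match constr:(tt) with _ => unify a b end in constr:(O)
    | _ => let i := mod_index a env' in constr:(S i)
    end
  end.

Ltac mod_mem a env :=
  lazymatch env with
  | ?b :: ?env' =>
    match constr:(tt) with
    | _ => let _ := match constr:(tt) with _ => unify a b end in constr:(true)
    | _ => mod_mem a env'
    end
  | _ => constr:(false)
  end.

Ltac mod_atoms t env :=
  lazymatch t with
  | (?x + ?y)%R => let env := mod_atoms x env in mod_atoms y env
  | (- ?x)%R => mod_atoms x env
  | (_ *: ?x)%R => mod_atoms x env
  | 0%R => env
  | _ => lazymatch mod_mem t env with
         | true => env
         | false => constr:(t :: env)
         end
  end.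

Ltac mod_reify K t env :=
  lazymatch t with
  | (?x + ?y)%R => let x := mod_reify K x env in let y := mod_reify K y env in
                   constr:(MAdd x y)
  | (- ?x)%R => let x := mod_reify K x env in constr:(MOpp x)
  | (?a *: ?x)%R => let x := mod_reify K x env in constr:(MScale (a : K) x)
  | 0%R => constr:(MZero K)
  | _ => let i := mod_index t env in constr:(MVar K i)
  end.

(* Compares the coefficients of the atoms on both sides of an equation in an
   [R]-module. *)
Ltac module_eq R :=
  lazymatch goal with
  | |- @eq ?T ?l ?r =>
    let K := constr:(GRing.ComNzRing.sort R) in
    let env := mod_atoms l (@nil T) in
    let env := mod_atoms r env in
    let tl := mod_reify K l env in
    let tr := mod_reify K r env in
    refine (@meval_eq _ _ env tl tr _);
    cbn [mcoef_eq mcoef size eqn]; repeat split; ring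
  end.

(** * Homogeneous sections as graded sections *)

Section HomogeneousSections.
Variables (R : realType) (M : manifold R) (U : set M) (E : nat -> vbundle U).

(** Extension by zero to the other degrees. The fibre type depends on the degree, so the value is
    cast along the proof of equality that the test returns. *)
Definition gsec_of k (s : forall p, E k p) : gsec E := fun i p =>
  if @eqP _ k i is ReflectT e then ecast j (E j p) e (s p) else 0.

Lemma gsec_of_id k (s : forall p, E k p) p : gsec_of s k p = s p.
Proof. by rewrite /gsec_of; case: eqP => // e; rewrite (eq_axiomK e). Qed.

Lemma gsec_of_neq k (s : forall p, E k p) i p : i != k -> gsec_of s i p = 0.
Proof. by rewrite /gsec_of; case: eqP => // e; case: i / e; rewrite eqxx. Qed.

Lemma hsec_gsec_of V k (s : forall p, E k p) :
  smooth_section V s -> hsec V k (gsec_of s).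
Proof.
move=> ss; split=> [|i ik p Vp]; last exact: gsec_of_neq.
have -> // : gsec_of s k = s.
by apply: functional_extensionality_dep => p; exact: gsec_of_id.
Qed.

Lemma geq_gsec_of V k (x : gsec E) :
  hsec V k x -> Defs.geq V x (gsec_of (x k)).
Proof.
move=> [_ x0] i p Vp; have [->|ik] := eqVneq i k; first by rewrite gsec_of_id.
by rewrite x0// gsec_of_neq.
Qed.

Lemma gsec_of_eq V k (s t : forall p, E k p) :
  (forall p, V p -> s p = t p) -> Defs.geq V (gsec_of s) (gsec_of t).
Proof.
move=> st i p Vp; have [->|ik] := eqVneq i k; first by rewrite !gsec_of_id st.
by rewrite !gsec_of_neq.
Qed.

Lemma gsec_of_lin k (f : M -> R) (s t : forall p, E k p) :
  gsec_of (fun p => f p *: s p + t p) = glin f (gsec_of s) (gsec_of t).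
Proof.
apply: functional_extensionality_dep => i.
apply: functional_extensionality_dep => p.
have [->|ik] := eqVneq i k; first by rewrite /glin !gsec_of_id.
by rewrite /glin !gsec_of_neq// scaler0 addr0.
Qed.

End HomogeneousSections.

Lemma near_nbhd (T : topologicalType) (U : set T) (p : T) (P : T -> Prop) :
  open U -> U p -> (\near p, P p) ->
  exists V, [/\ open V, V p, V `<=` U & forall q, V q -> P q].
Proof.
move=> oU Up nP; have : nbhs p P by exact: nP.
rewrite nbhsE => -[V [oV Vp] VP]; exists (V `&` U); split => //.
- exact: openI.
- by move=> q [/VP].
Qed.

(** For numerical arguments this evaluates to an explicit list of unshuffles with their sign
    exponents, that is, to one block of a Jacobi identity. *)
Definition jacobi_list n ks i : seq (seq nat * nat) :=
  [seq (l, koszul_exp n ks l) | l <- permutations (iota 0 n) & is_unshuffle n i l].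

Section Brackets.
Variables (R : realType) (M : manifold R) (U : set M).
Variable A : lie_infty_algebroid U.
Implicit Types (V : set M) (p : M) (x y z : gsec A) (xs : seq (gsec A)).

Lemma brk_jacobi_list V ks xs d p : open V -> V `<=` U -> (0 < size xs)%N ->
  hsecs V ks xs -> V p ->
  \sum_(1 <= i < (size xs).+1) \sum_(t <- jacobi_list (size xs) ks i)
      (-1) ^+ t.2 *:
        la_brk (la_brk [seq nth (gsec0 A) xs a | a <- take i t.1]
                :: [seq nth (gsec0 A) xs a | a <- drop i t.1]) d p = 0.
Proof.
move=> oV VU s0 hx Vp; rewrite -[RHS](brk_jacobi d oV VU s0 hx Vp).
by apply: eq_bigr => i _; rewrite big_map big_filter.
Qed.

Lemma jacobi2 V x y d p : open V -> V `<=` U -> hsecs V [:: 1; 2]%N [:: x; y] ->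
  V p ->
  la_brk [:: la_brk [:: x]; y] d p + la_brk [:: la_brk [:: y]; x] d p
    + la_brk [:: la_brk [:: x; y]] d p = 0.
Proof.
move=> oV VU hx Vp.
have := brk_jacobi_list (xs := [:: x; y]) d oV VU isT hx Vp.
rewrite /= big_ltn// big_ltn// big_geq//.
set l1 := jacobi_list _ _ _; have -> : l1 = [:: ([:: 0; 1], 0); ([:: 1; 0], 2)]%N.
  by vm_compute.
set l2 := jacobi_list _ _ _; have -> : l2 = [:: ([:: 0; 1], 0)]%N.
  by vm_compute.
rewrite !big_cons !big_nil /= => <-; module_eq R.
Qed.

(** The factor [(-1) ^+ k] is the sign for moving z past one argument of degree -1; moving it past
    both costs nothing. The case k = 1 yields the Jacobi identity up to homotopy, the case k = 2 the
    module identity. *)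
Lemma jacobi3 k V x y z d p : (k == 1)%N || (k == 2)%N -> open V -> V `<=` U ->
  hsecs V [:: 1; 1; k]%N [:: x; y; z] -> V p ->
  la_brk [:: la_brk [:: x]; y; z] d p - la_brk [:: la_brk [:: y]; x; z] d p
  + la_brk [:: la_brk [:: z]; x; y] d p
  + la_brk [:: la_brk [:: x; y]; z] d p
  + (-1) ^+ k *: la_brk [:: la_brk [:: x; z]; y] d p
  - (-1) ^+ k *: la_brk [:: la_brk [:: y; z]; x] d p
  + la_brk [:: la_brk [:: x; y; z]] d p = 0.
Proof.
move=> k12 oV VU hx Vp.
have := brk_jacobi_list (xs := [:: x; y; z]) d oV VU isT hx Vp.
rewrite /= big_ltn// big_ltn// big_ltn// big_geq//.
case/orP: k12 => /eqP k12; subst k.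
- set l1 := jacobi_list _ _ _.
  have -> : l1 = [:: ([:: 1; 0; 2], 1); ([:: 0; 1; 2], 0);
    ([:: 2; 0; 1], 2)]%N by vm_compute.
  set l2 := jacobi_list _ _ _.
  have -> : l2 = [:: ([:: 0; 1; 2], 0); ([:: 0; 2; 1], 1);
    ([:: 1; 2; 0], 2)]%N by vm_compute.
  set l3 := jacobi_list _ _ _; have -> : l3 = [:: ([:: 0; 1; 2], 0)]%N.
    by vm_compute.
  rewrite !big_cons !big_nil /= => <-; module_eq R.
- set l1 := jacobi_list _ _ _.
  have -> : l1 = [:: ([:: 1; 0; 2], 1); ([:: 0; 1; 2], 0);
    ([:: 2; 0; 1], 4)]%N by vm_compute.
  set l2 := jacobi_list _ _ _.
  have -> : l2 = [:: ([:: 0; 1; 2], 0); ([:: 0; 2; 1], 2);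
    ([:: 1; 2; 0], 3)]%N by vm_compute.
  set l3 := jacobi_list _ _ _; have -> : l3 = [:: ([:: 0; 1; 2], 0)]%N.
    by vm_compute.
  rewrite !big_cons !big_nil /= => <-; module_eq R.
Qed.

Lemma jacobi4 V x y z w d p : open V -> V `<=` U ->
  hsecs V [:: 1; 1; 1; 1]%N [:: x; y; z; w] -> V p ->
  la_brk [:: la_brk [:: x]; y; z; w] d p
  - la_brk [:: la_brk [:: y]; x; z; w] d p
  + la_brk [:: la_brk [:: z]; x; y; w] d p
  - la_brk [:: la_brk [:: w]; x; y; z] d p
  + (la_brk [:: la_brk [:: x; y]; z; w] d p
     - la_brk [:: la_brk [:: x; z]; y; w] d p
     + la_brk [:: la_brk [:: x; w]; y; z] d p
     + la_brk [:: la_brk [:: y; z]; x; w] d p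
     - la_brk [:: la_brk [:: y; w]; x; z] d p
     + la_brk [:: la_brk [:: z; w]; x; y] d p)
  + (la_brk [:: la_brk [:: x; y; z]; w] d p
     - la_brk [:: la_brk [:: x; y; w]; z] d p
     + la_brk [:: la_brk [:: x; z; w]; y] d p
     - la_brk [:: la_brk [:: y; z; w]; x] d p)
  + la_brk [:: la_brk [:: x; y; z; w]] d p = 0.
Proof.
move=> oV VU hx Vp.
have := brk_jacobi_list (xs := [:: x; y; z; w]) d oV VU isT hx Vp.
rewrite /= big_ltn// big_ltn// big_ltn// big_ltn// big_geq//.
set l1 := jacobi_list _ _ _.
have -> : l1 = [:: ([:: 2; 0; 1; 3], 2); ([:: 1; 0; 2; 3], 1);
  ([:: 0; 1; 2; 3], 0); ([:: 3; 0; 1; 2], 3)]%N by vm_compute.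
set l2 := jacobi_list _ _ _.
have -> : l2 = [:: ([:: 1; 2; 0; 3], 2); ([:: 0; 2; 1; 3], 1);
  ([:: 0; 1; 2; 3], 0); ([:: 1; 3; 0; 2], 3); ([:: 0; 3; 1; 2], 2);
  ([:: 2; 3; 0; 1], 4)]%N by vm_compute.
set l3 := jacobi_list _ _ _.
have -> : l3 = [:: ([:: 0; 1; 2; 3], 0); ([:: 0; 1; 3; 2], 1);
  ([:: 0; 2; 3; 1], 2); ([:: 1; 2; 3; 0], 3)]%N by vm_compute.
set l4 := jacobi_list _ _ _.
have -> : l4 = [:: ([:: 0; 1; 2; 3], 0)]%N by vm_compute.
rewrite !big_cons !big_nil /= => <-; module_eq R.
Qed.

(** Linearity with f = 1 gives B(0) = B(0) + B(0). One further argument is excluded because the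
    binary bracket is not O-linear. *)
Lemma brk_zero V ks xs d p : open V -> V `<=` U -> hsecs V ks xs ->
  size xs != 1%N -> V p -> la_brk (gsec0 A :: xs) d p = 0.
Proof.
move=> oV VU hx s1 Vp.
have h0 : hsec V 0 (gsec0 A).
  split => //; apply: smooth_section_local => // q _; exact: section_at0.
have := @la_linear _ _ _ A V (size xs) (fun j => nth 0%N ks j)
  (fun j => nth (gsec0 A) xs j) 0%N (gsec0 A) (gsec0 A) (fun=> 1) oV VU s1 _
  (fun j => hsecs_nth hx (ltn_ord j)) h0 h0.
have -> : glin (fun=> 1) (gsec0 A) (gsec0 A) = gsec0 A.
  apply: functional_extensionality_dep => i.
  by apply: functional_extensionality_dep => q; rewrite /glin scaler0 addr0.
rewrite codom_nth /glin => /(_ _ d p Vp); rewrite scale1r => H.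
have /H : smooth_on V (fun=> 1 : R).
  by apply: smooth_on_local => // q _; exact: smooth_at_cst.
by move/(congr1 (fun v => v - la_brk (gsec0 A :: xs) d p)); rewrite addrK subrr.
Qed.

(** In the Leibniz rule the anchor term multiplies the zero section; graded symmetry then moves the
    zero to the first slot. *)
Lemma brk_zero2 V k x d p : open V -> V `<=` U -> hsec V k x -> V p ->
  la_brk [:: gsec0 A; x] d p = 0.
Proof.
move=> oV VU hx Vp.
have h0 : hsec V 0 (gsec0 A).
  split => //; apply: smooth_section_local => // q _; exact: section_at0.
have s1 : smooth_on V (fun=> 1 : R).
  by apply: smooth_on_local => // q _; exact: smooth_at_cst.
have := la_leibniz oV VU s1 hx h0 h0 d Vp.
have -> : glin (fun=> 1) (gsec0 A) (gsec0 A) = gsec0 A.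
  apply: functional_extensionality_dep => i.
  by apply: functional_extensionality_dep => q; rewrite /glin scaler0 addr0.
rewrite scale1r scaler0 addr0.
move/(congr1 (fun v => v - la_brk [:: x; gsec0 A] d p)); rewrite addrK subrr.
have := @brk_sym _ _ _ A V [:: k; 0]%N [:: x; gsec0 A] [:: 1; 0]%N d p oV VU.
by move=> /(_ isT (conj hx (conj h0 I)) isT Vp) /= -> <-; rewrite scaler0.
Qed.

(* A section of degree -1 has no unary bracket since E_0 = 0. *)
Lemma brk_unary1 V x : open V -> V `<=` U -> hsec V 1 x ->
  Defs.geq V (la_brk [:: x]) (gsec0 A).
Proof.
move=> oV VU hx [|i] p Vp.
  by rewrite [LHS](ac_bundle0 (VU _ Vp)).
have [_ ->//] := @brk_degree _ _ _ A V [:: 1]%N [:: x] oV VU isT (conj hx I).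
Qed.

End Brackets.

(** * Brackets of sections of degrees -1 and -2 *)

Section TypedBrackets.
Variables (R : realType) (M : manifold R) (U : set M).
Variable A : lie_infty_algebroid U.
Hypothesis oU : open U.
Implicit Types (V : set M) (p : M) (f : M -> R).

Local Notation sect k := (forall q, A k q).

(** Brackets typed by degree, from sections of single bundles to sections of single bundles; graded
    sections disappear from the later arguments. *)
Definition bra l (X : sect 1%N) (Y : sect l) : sect l :=
  fun q => la_brk [:: gsec_of X; gsec_of Y] l q.

Definition tri (X Y Z : sect 1%N) : sect 2%N :=
  fun q => la_brk [:: gsec_of X; gsec_of Y; gsec_of Z] 2%N q.

Definition dsec (V : sect 2%N) : sect 1%N := fun q => ac_d A 1 q (V q).

Definition anchor_app (X : sect 1%N) f : M -> R := fun q => ac_rho A q (X q) f.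

(** One neighbourhood for up to four germs, as many as the largest Jacobi identity below has
    arguments; with fewer germs one of them is repeated. *)
Lemma brk_nbhd p (P : M -> Prop) k1 (X1 : sect k1) k2 (X2 : sect k2)
    k3 (X3 : sect k3) k4 (X4 : sect k4) : U p -> (\near p, P p) ->
  section_at p X1 -> section_at p X2 -> section_at p X3 -> section_at p X4 ->
  exists V, [/\ open V, V p, V `<=` U, forall q, V q -> P q &
    [/\ hsec V k1 (gsec_of X1), hsec V k2 (gsec_of X2),
        hsec V k3 (gsec_of X3) & hsec V k4 (gsec_of X4)]].
Proof.
move=> Up nP /section_at_near g1 /section_at_near g2 /section_at_near g3
  /section_at_near g4.
have /(near_nbhd oU Up)[V [oV Vp VU VP]] : \near p, P p /\
    [/\ section_at p X1, section_at p X2, section_at p X3 & section_at p X4].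
  by near=> q; split; [near: q|split; near: q].
exists V; split => //; first by move=> q /VP[].
by split; apply: hsec_gsec_of; apply: smooth_section_local => // q /VP[_ []].
Unshelve. all: by end_near. Qed.

Lemma bra_section p l (X : sect 1%N) (Y : sect l) : U p ->
  section_at p X -> section_at p Y -> section_at p (bra X Y).
Proof.
move=> Up gX gY.
have [V [oV Vp VU _ [hX hY _ _]]] :=
  @brk_nbhd p (fun=> True) _ _ _ _ _ _ _ _ Up filterT gX gY gX gX.
exists V; split => //.
have [+ _] := @brk_degree _ _ _ A V [:: 1%N; l] [:: gsec_of X; gsec_of Y]
  oV VU isT (conj hX (conj hY I)).
by rewrite /= addn0.
Qed.

Lemma bra_eq p l (X X' : sect 1%N) (Y Y' : sect l) : U p ->
  section_at p X -> section_at p X' -> section_at p Y -> section_at p Y' ->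
  (\near p, X p = X' p) -> (\near p, Y p = Y' p) -> bra X Y p = bra X' Y' p.
Proof.
move=> Up gX gX' gY gY' XX' YY'.
have XY : \near p, X p = X' p /\ Y p = Y' p.
  by near=> q; split; near: q.
have [V [oV Vp VU VP [hX hX' hY hY']]] := brk_nbhd Up XY gX gX' gY gY'.
have := @brk_local _ _ _ A V [:: 1%N; l] [:: gsec_of X; gsec_of Y]
  [:: gsec_of X'; gsec_of Y'] oV VU isT (conj hX (conj hY I))
  (conj hX' (conj hY' I)) _ l p Vp; apply.
by move=> [|[|j]] //=; apply: gsec_of_eq => q /VP[].
Unshelve. all: by end_near. Qed.

Lemma bra_leibniz p l f (X : sect 1%N) (Y Z : sect l) : U p -> smooth_at p f ->
  section_at p X -> section_at p Y -> section_at p Z ->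
  bra X (fun q => f q *: Y q + Z q) p =
    f p *: bra X Y p + anchor_app X f p *: Y p + bra X Z p.
Proof.
move=> Up /smooth_at_near sf gX gY gZ.
have [V [oV Vp VU VP [hX hY hZ _]]] := brk_nbhd Up sf gX gY gZ gX.
have := la_leibniz oV VU (smooth_on_local oV VP) hX hY hZ l Vp.
by rewrite -gsec_of_lin /= !gsec_of_id.
Qed.

Lemma bra_skew p (X Y : sect 1%N) : U p -> section_at p X -> section_at p Y ->
  bra X Y p = - bra Y X p.
Proof.
move=> Up gX gY.
have [V [oV Vp VU _ [hX hY _ _]]] :=
  @brk_nbhd p (fun=> True) _ _ _ _ _ _ _ _ Up filterT gX gY gX gX.
have := @brk_sym _ _ _ A V [:: 1; 1]%N [:: gsec_of Y; gsec_of X] [:: 1; 0]%N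
  1%N p oV VU isT (conj hY (conj hX I)) isT Vp.
have -> : koszul_exp (size [:: gsec_of Y; gsec_of X]) [:: 1; 1]%N [:: 1; 0]%N
  = 1%N by vm_compute.
by rewrite /= expr1 scaleN1r.
Qed.

Lemma bra_swap2 p (X : sect 1%N) (Y : sect 2%N) : U p ->
  section_at p X -> section_at p Y ->
  bra X Y p = la_brk [:: gsec_of Y; gsec_of X] 2 p.
Proof.
move=> Up gX gY.
have [V [oV Vp VU _ [hX hY _ _]]] :=
  @brk_nbhd p (fun=> True) _ _ _ _ _ _ _ _ Up filterT gX gY gX gX.
have := @brk_sym _ _ _ A V [:: 2; 1]%N [:: gsec_of Y; gsec_of X] [:: 1; 0]%N
  2%N p oV VU isT (conj hY (conj hX I)) isT Vp.
have -> : koszul_exp (size [:: gsec_of Y; gsec_of X]) [:: 2; 1]%N [:: 1; 0]%N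
  = 2%N by vm_compute.
by rewrite /= sqrrN expr1n scale1r.
Qed.

(** Exchanging degrees -1 and -2 costs no sign, and the Leibniz rule with a first argument of degree
    -2 has no anchor term. *)
Lemma bra_linear2 p f (X Y : sect 1%N) (Z : sect 2%N) : U p -> smooth_at p f ->
  section_at p X -> section_at p Y -> section_at p Z ->
  bra (fun q => f q *: X q + Y q) Z p = f p *: bra X Z p + bra Y Z p.
Proof.
move=> Up sf gX gY gZ; have sf' := smooth_at_near sf.
rewrite !bra_swap2//; last exact: section_at_lin.
have [V [oV Vp VU VP [hX hY hZ _]]] := brk_nbhd Up sf' gX gY gZ gX.
have := la_leibniz oV VU (smooth_on_local oV VP) hZ hX hY 2%N Vp.
by rewrite -gsec_of_lin /= scale0r addr0.
Qed.

Lemma tri_section p (X Y Z : sect 1%N) : U p ->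
  section_at p X -> section_at p Y -> section_at p Z ->
  section_at p (tri X Y Z).
Proof.
move=> Up gX gY gZ.
have [V [oV Vp VU _ [hX hY hZ _]]] :=
  @brk_nbhd p (fun=> True) _ _ _ _ _ _ _ _ Up filterT gX gY gZ gX.
exists V; split => //.
have [+ _] := @brk_degree _ _ _ A V [:: 1; 1; 1]%N
  [:: gsec_of X; gsec_of Y; gsec_of Z]
  oV VU isT (conj hX (conj hY (conj hZ I))).
exact.
Qed.

Lemma tri_eq p (X X' Y Z : sect 1%N) : U p ->
  section_at p X -> section_at p X' -> section_at p Y -> section_at p Z ->
  (\near p, X p = X' p) -> tri X Y Z p = tri X' Y Z p.
Proof.
move=> Up gX gX' gY gZ XX'.
have [V [oV Vp VU VP [hX hX' hY hZ]]] := brk_nbhd Up XX' gX gX' gY gZ.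
have := @brk_local _ _ _ A V [:: 1; 1; 1]%N [:: gsec_of X; gsec_of Y; gsec_of Z]
  [:: gsec_of X'; gsec_of Y; gsec_of Z] oV VU isT
  (conj hX (conj hY (conj hZ I))) (conj hX' (conj hY (conj hZ I))) _ 2%N p Vp.
by apply=> -[|[|[|j]]] //=; exact: gsec_of_eq.
Qed.

Lemma tri_skew12 p (X Y Z : sect 1%N) : U p ->
  section_at p X -> section_at p Y -> section_at p Z ->
  tri X Y Z p = - tri Y X Z p.
Proof.
move=> Up gX gY gZ.
have [V [oV Vp VU _ [hX hY hZ _]]] :=
  @brk_nbhd p (fun=> True) _ _ _ _ _ _ _ _ Up filterT gX gY gZ gX.
have := @brk_sym _ _ _ A V [:: 1; 1; 1]%N [:: gsec_of Y; gsec_of X; gsec_of Z]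
  [:: 1; 0; 2]%N 2%N p oV VU isT (conj hY (conj hX (conj hZ I))) isT Vp.
have -> : koszul_exp (size [:: gsec_of Y; gsec_of X; gsec_of Z])
  [:: 1; 1; 1]%N [:: 1; 0; 2]%N = 1%N by vm_compute.
by rewrite /= expr1 scaleN1r.
Qed.

Lemma tri_skew23 p (X Y Z : sect 1%N) : U p ->
  section_at p X -> section_at p Y -> section_at p Z ->
  tri X Y Z p = - tri X Z Y p.
Proof.
move=> Up gX gY gZ.
have [V [oV Vp VU _ [hX hY hZ _]]] :=
  @brk_nbhd p (fun=> True) _ _ _ _ _ _ _ _ Up filterT gX gY gZ gX.
have := @brk_sym _ _ _ A V [:: 1; 1; 1]%N [:: gsec_of X; gsec_of Z; gsec_of Y]
  [:: 0; 2; 1]%N 2%N p oV VU isT (conj hX (conj hZ (conj hY I))) isT Vp.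
have -> : koszul_exp (size [:: gsec_of X; gsec_of Z; gsec_of Y])
  [:: 1; 1; 1]%N [:: 0; 2; 1]%N = 1%N by vm_compute.
by rewrite /= expr1 scaleN1r.
Qed.

Lemma tri_linear p f (X X' Y Z : sect 1%N) : U p -> smooth_at p f ->
  section_at p X -> section_at p X' -> section_at p Y -> section_at p Z ->
  tri (fun q => f q *: X q + X' q) Y Z p = f p *: tri X Y Z p + tri X' Y Z p.
Proof.
move=> Up /smooth_at_near sf gX gX' gY gZ.
have [V [oV Vp VU VP [hX hX' hY hZ]]] := brk_nbhd Up sf gX gX' gY gZ.
have hs : hsecs V [:: 1; 1]%N [:: gsec_of Y; gsec_of Z] by [].
have := @la_linear _ _ _ A V 2 (fun j => nth 0%N [:: 1; 1]%N j)
  (fun j => nth (gsec0 A) [:: gsec_of Y; gsec_of Z] j) 1%N (gsec_of X)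
  (gsec_of X') f oV VU isT (smooth_on_local oV VP)
  (fun j => hsecs_nth hs (ltn_ord j)) hX hX' 2%N p Vp.
rewrite (codom_nth (gsec0 A) [:: gsec_of Y; gsec_of Z]).
by rewrite -gsec_of_lin.
Qed.

Lemma anchor_app_smooth p f (X : sect 1%N) : U p -> section_at p X ->
  smooth_at p f -> smooth_at p (anchor_app X f).
Proof.
move=> Up gX /smooth_at_near sf.
have [V [oV Vp VU VP [hX _ _ _]]] := brk_nbhd Up sf gX gX gX gX.
exists V; split => //; have [sX _] := hX.
have /(@ac_rho_smooth _ _ _ A V _ oV VU)/(_ V f oV) := sX.
move=> /(_ (fun q Vq => Vq) (smooth_on_local oV VP)).
by congr smooth_on; apply/funext => q; rewrite /anchor_app gsec_of_id.
Qed.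

Lemma dsec_section p (Y : sect 2%N) : U p -> section_at p Y ->
  section_at p (dsec Y).
Proof.
move=> Up gY; apply: (morphism_at_section (phi := fun q => ac_d A 1 q)) gY.
by exists U; split => //; exact: ac_d_smooth.
Qed.

(* The inner bracket of a nested bracket is only used through its homogeneous
   component. *)
Lemma brk_nested p k (X : sect k) V xs ys ks ks' : open V -> V `<=` U -> V p ->
  (0 < size xs)%N -> hsecs V ks xs -> (sumn ks).-1 = k ->
  (forall q, V q -> la_brk xs k q = X q) ->
  hsecs V ks' ys -> forall d,
  la_brk (la_brk xs :: ys) d p = la_brk (gsec_of X :: ys) d p.
Proof.
move=> oV VU Vp s0 hx ek eX hy d.
have := brk_degree oV VU s0 hx; rewrite ek => hb.
have gb : Defs.geq V (la_brk xs) (gsec_of X).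
  move=> i q Vq; rewrite (geq_gsec_of hb)//.
  exact: (@gsec_of_eq _ _ _ A V).
have hX : hsec V k (gsec_of X).
  apply: hsec_gsec_of; have [sb _] := hb => t at_ j.
  have oVt : open (V `&` triv_dom t) := openI oV (triv_dom_open t).
  apply: smooth_on_local => // q Vtq.
  apply: (@smooth_at_eq _ _ _ _ (fun q => triv_map t q (la_brk xs k q) 0 j)).
    near=> r; rewrite eX//; suff [] : (V `&` triv_dom t) r by [].
    by near: r; exact: open_nbhs_nbhs.
  by exists (V `&` triv_dom t); split => //; exact: sb.
apply: (@brk_local _ _ _ A V (k :: ks') (la_brk xs :: ys) (gsec_of X :: ys)) => //.
by move=> [|j].
Unshelve. all: by end_near. Qed.

Lemma brk_nested_unary1 p (X : sect 1%N) V ys ks : open V -> V `<=` U -> V p ->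
  hsec V 1 (gsec_of X) -> hsecs V ks ys -> (0 < size ys)%N ->
  forall d, la_brk (la_brk [:: gsec_of X] :: ys) d p = 0.
Proof.
move=> oV VU Vp hX hy s0 d.
have h0 : hsec V 0 (gsec0 A).
  split => //; apply: smooth_section_local => // q _; exact: section_at0.
have hb := @brk_degree _ _ _ A V [:: 1%N] [:: gsec_of X] oV VU isT (conj hX I).
rewrite (@brk_local _ _ _ A V (0%N :: ks) (_ :: ys) (gsec0 A :: ys)
  _ _ _ _ _ _ d p Vp)//;
  last by move=> [|j] //=; exact: brk_unary1.
(* With one further argument the outer bracket is binary and obeys the Leibniz rule instead of
   linearity. *)
have [s1|s1] := eqVneq (size ys) 1%N; last exact: brk_zero hy s1 Vp.
case: ys ks hy s0 s1 => [|y [|? ?]] // [|k [|? ?]] [] // hy _ _ _.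
exact: brk_zero2 hy Vp.
Qed.

Lemma brk_unary_outer V p ks xs d : open V -> V `<=` U -> V p ->
  (0 < size xs)%N -> hsecs V ks xs ->
  la_brk [:: la_brk xs] d p = ac_d A d p (la_brk xs d.+1 p).
Proof.
by move=> oV VU Vp s0 hx; rewrite (la_unary oV VU (brk_degree oV VU s0 hx)).
Qed.

(** The differential is a derivation of the binary bracket; the term with dX drops out because E_0 =
    0. *)
Lemma bra_d p (X : sect 1%N) (Y : sect 2%N) : U p ->
  section_at p X -> section_at p Y ->
  ac_d A 1 p (bra X Y p) = bra X (dsec Y) p.
Proof.
move=> Up gX gY; have gdY := dsec_section Up gY.
have [V [oV Vp VU _ [hX hY hdY _]]] :=
  @brk_nbhd p (fun=> True) _ _ _ _ _ _ _ _ Up filterT gX gY gdY gX.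
have := jacobi2 1%N oV VU (conj hX (conj hY I)) Vp.
rewrite (@brk_nested_unary1 p X V _ [:: 2%N])//.
rewrite (@brk_nested p 1 (dsec Y) V _ _ [:: 2%N] [:: 1%N])//; last first.
  by move=> q Vq; rewrite (la_unary oV VU hY)// gsec_of_id.
rewrite (@brk_unary_outer V p [:: 1; 2]%N)// add0r.
move/eqP; rewrite addrC addr_eq0 => /eqP ->.
by rewrite (bra_skew Up gX gdY).
Qed.

Lemma bra_jacobi p (X Y Z : sect 1%N) : U p ->
  section_at p X -> section_at p Y -> section_at p Z ->
  bra (bra X Y) Z p - bra (bra X Z) Y p + bra (bra Y Z) X p
    + ac_d A 1 p (tri X Y Z p) = 0.
Proof.
move=> Up gX gY gZ.
have [V [oV Vp VU _ [hX hY hZ _]]] :=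
  @brk_nbhd p (fun=> True) _ _ _ _ _ _ _ _ Up filterT gX gY gZ gX.
have := jacobi3 1%N (isT : (1 == 1) || (1 == 2))%N oV VU
  (conj hX (conj hY (conj hZ I))) Vp.
rewrite !(@brk_nested_unary1 p _ V _ [:: 1; 1]%N)//.
rewrite (@brk_nested p 1 (bra X Y) V _ _ [:: 1; 1]%N [:: 1%N])//.
rewrite (@brk_nested p 1 (bra X Z) V _ _ [:: 1; 1]%N [:: 1%N])//.
rewrite (@brk_nested p 1 (bra Y Z) V _ _ [:: 1; 1]%N [:: 1%N])//.
rewrite (@brk_unary_outer V p [:: 1; 1; 1]%N)//.
rewrite -/(bra (bra X Y) Z p) -/(bra (bra X Z) Y p) -/(bra (bra Y Z) X p).
by rewrite -/(tri X Y Z p) => <-; module_eq R.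
Qed.

(** T is the ternary bracket of X, Y and Z, of degree -3. It only enters through a differential,
    which vanishes at a point of minimality, so its existence is all that is kept. *)
Lemma bra_jacobi2 p (X Y : sect 1%N) (Z : sect 2%N) : U p ->
  section_at p X -> section_at p Y -> section_at p Z ->
  exists T : A 3%N p, tri (dsec Z) X Y p + bra (bra X Y) Z p
    + bra Y (bra X Z) p - bra X (bra Y Z) p + ac_d A 2 p T = 0.
Proof.
move=> Up gX gY gZ; have gdZ := dsec_section Up gZ.
have gXY := bra_section Up gX gY; have gXZ := bra_section Up gX gZ.
have gYZ := bra_section Up gY gZ.
have [V [oV Vp VU _ [hX hY hZ hdZ]]] :=
  @brk_nbhd p (fun=> True) _ _ _ _ _ _ _ _ Up filterT gX gY gZ gdZ.
have := jacobi3 2%N (isT : (2 == 1) || (2 == 2))%N oV VU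
  (conj hX (conj hY (conj hZ I))) Vp.
rewrite !(@brk_nested_unary1 p _ V _ [:: 1; 2]%N)//.
rewrite (@brk_nested p 1 (dsec Z) V _ _ [:: 2]%N [:: 1%N; 1%N])//; last first.
  by move=> q Vq; rewrite (la_unary oV VU hZ)// gsec_of_id.
rewrite (@brk_nested p 1 (bra X Y) V _ _ [:: 1; 1]%N [:: 2%N])//.
rewrite (@brk_nested p 2 (bra X Z) V _ _ [:: 1; 2]%N [:: 1%N])//.
rewrite (@brk_nested p 2 (bra Y Z) V _ _ [:: 1; 2]%N [:: 1%N])//.
rewrite (@brk_unary_outer V p [:: 1; 1; 2]%N)//.
rewrite -(bra_swap2 Up gY gXZ) -(bra_swap2 Up gX gYZ).
rewrite -/(bra (bra X Y) Z p) -/(tri (dsec Z) X Y p).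
by set T := la_brk _ _ p => J; exists T; rewrite -J; module_eq R.
Qed.

Lemma tri_jacobi p (X Y Z W : sect 1%N) : U p ->
  section_at p X -> section_at p Y -> section_at p Z -> section_at p W ->
  exists T : A 3%N p,
    (tri (bra X Y) Z W p - tri (bra X Z) Y W p + tri (bra X W) Y Z p
     + tri (bra Y Z) X W p - tri (bra Y W) X Z p + tri (bra Z W) X Y p)
    + (bra W (tri X Y Z) p - bra Z (tri X Y W) p + bra Y (tri X Z W) p
       - bra X (tri Y Z W) p) + ac_d A 2 p T = 0.
Proof.
move=> Up gX gY gZ gW.
have [V [oV Vp VU _ [hX hY hZ hW]]] :=
  @brk_nbhd p (fun=> True) _ _ _ _ _ _ _ _ Up filterT gX gY gZ gW.
have := jacobi4 2%N oV VU (conj hX (conj hY (conj hZ (conj hW I)))) Vp.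
rewrite !(@brk_nested_unary1 p _ V _ [:: 1; 1; 1]%N)//.
rewrite (@brk_nested p 1 (bra X Y) V _ _ [:: 1; 1]%N [:: 1%N; 1%N])//.
rewrite (@brk_nested p 1 (bra X Z) V _ _ [:: 1; 1]%N [:: 1%N; 1%N])//.
rewrite (@brk_nested p 1 (bra X W) V _ _ [:: 1; 1]%N [:: 1%N; 1%N])//.
rewrite (@brk_nested p 1 (bra Y Z) V _ _ [:: 1; 1]%N [:: 1%N; 1%N])//.
rewrite (@brk_nested p 1 (bra Y W) V _ _ [:: 1; 1]%N [:: 1%N; 1%N])//.
rewrite (@brk_nested p 1 (bra Z W) V _ _ [:: 1; 1]%N [:: 1%N; 1%N])//.
rewrite (@brk_nested p 2 (tri X Y Z) V _ _ [:: 1; 1; 1]%N [:: 1%N])//.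
rewrite (@brk_nested p 2 (tri X Y W) V _ _ [:: 1; 1; 1]%N [:: 1%N])//.
rewrite (@brk_nested p 2 (tri X Z W) V _ _ [:: 1; 1; 1]%N [:: 1%N])//.
rewrite (@brk_nested p 2 (tri Y Z W) V _ _ [:: 1; 1; 1]%N [:: 1%N])//.
rewrite (@brk_unary_outer V p [:: 1; 1; 1; 1]%N)//.
rewrite -!bra_swap2 //; try exact: tri_section.
rewrite -/(tri (bra X Y) Z W p) -/(tri (bra X Z) Y W p).
rewrite -/(tri (bra X W) Y Z p) -/(tri (bra Y Z) X W p).
rewrite -/(tri (bra Y W) X Z p) -/(tri (bra Z W) X Y p).
by set T := la_brk _ 3 p => J; exists T; rewrite -J; module_eq R.
Qed.

(* Compares the Jacobi identities for (X, Y, Z) and (X, Y, fZ + Z): the terms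
   that are not O-linear in Z must cancel. *)
Lemma anchor_bra_scale p f (X Y Z : sect 1%N) : U p -> smooth_at p f ->
  section_at p X -> section_at p Y -> section_at p Z ->
  (anchor_app (bra X Y) f p - anchor_app X (anchor_app Y f) p
     + anchor_app Y (anchor_app X f) p) *: Z p = 0.
Proof.
move=> Up sf gX gY gZ; set Z' := fun q => f q *: Z q + Z q.
have gZ' : section_at p Z' by exact: section_at_lin.
have nU : \near p, U p by apply: open_nbhs_nbhs.
have gXY := bra_section Up gX gY.
have nested (X1 Y1 : sect 1%N) : section_at p X1 -> section_at p Y1 ->
    bra (bra X1 Z') Y1 p = f p *: bra (bra X1 Z) Y1 p
      - anchor_app Y1 f p *: bra X1 Z p
      - anchor_app X1 f p *: bra Y1 Z p
      - anchor_app Y1 (anchor_app X1 f) p *: Z p + bra (bra X1 Z) Y1 p.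
  move=> gX1 gY1; have gX1Z := bra_section Up gX1 gZ.
  have gX1Z' := bra_section Up gX1 gZ'.
  have sX1 := anchor_app_smooth Up gX1 sf.
  have gin : section_at p (fun q => anchor_app X1 f q *: Z q + bra X1 Z q).
    exact: section_at_lin.
  have gout : section_at p (fun q => f q *: bra X1 Z q
      + (anchor_app X1 f q *: Z q + bra X1 Z q)) by exact: section_at_lin.
  rewrite (bra_skew Up gX1Z' gY1) (bra_skew Up gX1Z gY1).
  rewrite (bra_eq (Y' := fun q => f q *: bra X1 Z q
    + (anchor_app X1 f q *: Z q + bra X1 Z q)) Up gY1 gY1)//; first last.
  + have n1 := section_at_near gX1; have n2 := section_at_near gZ.
    have n3 := smooth_at_near sf.
    near=> q; rewrite addrA /Z' bra_leibniz//; near: q => //.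
  + by near=> q.
  rewrite !bra_leibniz//; module_eq R.
have J := bra_jacobi Up gX gY gZ; have J' := bra_jacobi Up gX gY gZ'.
(* Z is moved to the first slot, the one in which [tri_linear] applies. *)
rewrite (tri_skew23 Up gX gY gZ) (tri_skew12 Up gX gZ gY) opprK in J.
rewrite (nested X Y)// (nested Y X)// bra_leibniz// in J'.
rewrite (tri_skew23 Up gX gY gZ') (tri_skew12 Up gX gZ' gY) opprK in J'.
rewrite tri_linear// linearP in J'.
(* Since Z' = (f + 1) Z, subtracting [f p + 1] times the first identity from the second leaves only
   anchor terms. *)
rewrite -[RHS](subrr 0) -{1}J' -{1}[0](scaler0 _ (f p + 1)) -{1}J.
module_eq R.
Unshelve. all: by end_near. Qed.

(** A section Z that is nonzero at p can be cancelled from [anchor_bra_scale]. If the fibre at p is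
    zero there is no such Z, but then every anchor value at p vanishes. *)
Lemma anchor_bra p f (X Y : sect 1%N) : U p -> smooth_at p f ->
  section_at p X -> section_at p Y ->
  anchor_app (bra X Y) f p =
    anchor_app X (anchor_app Y f) p - anchor_app Y (anchor_app X f) p.
Proof.
move=> Up sf gX gY.
have [[x x0]|] := pselect (exists x : A 1%N p, x != 0); last first.
  move=> /forallNP A0; have {}A0 (x : A 1%N p) : x = 0.
    by apply/eqP/negP => /negP; exact: A0.
  by rewrite /anchor_app (A0 (bra X Y p)) (A0 (X p)) (A0 (Y p)) linear0 subrr.
have [Z gZ Zp] := section_extension x Up.
have /eqP := anchor_bra_scale Up sf gX gY gZ; rewrite Zp scaler_eq0 (negbTE x0).
by rewrite orbF -addrA addr_eq0 opprD !opprK => /eqP.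
Qed.

End TypedBrackets.

Section Tensoriality.
Variables (R : realType) (M : manifold R) (U : set M) (E : vbundle U).
Variables (q : M) (V : lmodType R).
Implicit Types (B : (forall p, E p) -> V).

Lemma tensorial0 B : tensorial_at q B -> B (fun p => 0) = 0.
Proof.
move=> [_ /(_ _ _ _ (smooth_at_cst q 1) (section_at0 E q) (section_at0 E q))].
have -> : (fun p => 1 *: 0 + 0) = (fun p => 0 : E p).
  by apply: functional_extensionality_dep => p; rewrite scaler0 addr0.
rewrite scale1r.
by move/(congr1 (fun v => v - B (fun p => 0))); rewrite addrK subrr.
Qed.

(** Carries tensoriality from one slot of a skew bracket to another. *)
Lemma tensorial_oppE B B' : tensorial_at q B ->
  (forall s, section_at q s -> B' s = - B s) -> tensorial_at q B'.
Proof.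
move=> [Beq Blin] BB'; split=> [s t gs gt st|f s t sf gs gt].
- by rewrite !BB'// (Beq s t).
- rewrite !BB'//; last exact: section_at_lin.
  by rewrite Blin//; module_eq R.
Qed.

End Tensoriality.

Arguments iso_cochain3 : simpl never.

(** * The Chevalley-Eilenberg differential of 2- and 3-cochains *)

Section ChevalleyEilenberg.
Variables (K : fieldType) (g : lmodType K) (br : g -> g -> g).
Variables (V : lmodType K) (act : g -> V -> V) (w : seq g -> V).

Lemma ce_diff3 x y z : ce_diff br act w [:: x; y; z] =
  act x (w [:: y; z]) - act y (w [:: x; z]) + act z (w [:: x; y])
  - w [:: br x y; z] + w [:: br x z; y] - w [:: br y z; x].
Proof.
rewrite /ce_diff; under [X in _ + X]eq_bigr do rewrite big_mkcond.
rewrite !big_ord_recl !big_ord0 /= /delete /= /bump /=.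
module_eq K.
Qed.

Lemma ce_diff4 x y z t : ce_diff br act w [:: x; y; z; t] =
  act x (w [:: y; z; t]) - act y (w [:: x; z; t]) + act z (w [:: x; y; t])
  - act t (w [:: x; y; z])
  - w [:: br x y; z; t] + w [:: br x z; y; t] - w [:: br x t; y; z]
  - w [:: br y z; x; t] + w [:: br y t; x; z] - w [:: br z t; x; y].
Proof.
rewrite /ce_diff; under [X in _ + X]eq_bigr do rewrite big_mkcond.
rewrite !big_ord_recl !big_ord0 /= /delete /= /bump /=.
module_eq K.
Qed.

End ChevalleyEilenberg.

(** * The isotropy brackets *)

Section Isotropy.
Variables (R : realType) (M : manifold R) (U : set M).
Variables (A : lie_infty_algebroid U) (m : M).
Hypotheses (oU : open U).
Local Notation sect k := (forall q, A k q).

(** Values on functions that are not smooth near p are normalized to 0, so smooth functions separate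
    tangent vectors. *)
Lemma tangent_eq0 p (v : tangent p) :
  (forall f, smooth_at p f -> (v : (M -> R) -> R) f = 0) -> v = 0.
Proof.
move=> v0; apply: val_inj; apply/funext => f.
have [/v0 //|nf] := pselect (smooth_at p f).
by have /asboolP[_ _ _ /(_ _ nf)] := valP v.
Qed.

Lemma anchor_app0 p (X : sect 1%N) f : ac_rho A p (X p) = 0 ->
  anchor_app X f p = 0.
Proof. by rewrite /anchor_app => ->. Qed.

Lemma anchor_bra0 p (X Y : sect 1%N) : U p ->
  section_at p X -> section_at p Y -> ac_rho A p (X p) = 0 ->
  ac_rho A p (Y p) = 0 -> ac_rho A p (bra X Y p) = 0.
Proof.
move=> Up gX gY X0 Y0; apply: tangent_eq0 => f sf.
rewrite -[LHS]/(anchor_app (bra X Y) f p) anchor_bra//.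
by rewrite !anchor_app0// subrr.
Qed.

(** The obstruction to linearity in Y is the derivative of f along the anchor of X, and it is
    evaluated at p only. *)
Lemma bra_tensorialr p l (X : sect 1%N) : U p -> section_at p X ->
  ac_rho A p (X p) = 0 -> tensorial_at p (fun Y : sect l => bra X Y p).
Proof.
move=> Up gX X0; split=> [s t gs gt st|f s t sf gs gt].
- by apply: bra_eq => //; near=> q.
- by rewrite bra_leibniz// anchor_app0// scale0r addr0.
Unshelve. all: by end_near. Qed.

Lemma bra_tensorial1 p (Y : sect 1%N) : U p -> section_at p Y ->
  ac_rho A p (Y p) = 0 -> tensorial_at p (fun X : sect 1%N => bra X Y p).
Proof.
move=> Up gY Y0; apply: (tensorial_oppE (@bra_tensorialr _ 1 _ Up gY Y0)) => s gs.
exact: bra_skew.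
Qed.

Lemma bra_tensorial2 p (Y : sect 2%N) : U p -> section_at p Y ->
  tensorial_at p (fun X : sect 1%N => bra X Y p).
Proof.
move=> Up gY; split=> [s t gs gt st|f s t sf gs gt].
- by apply: bra_eq => //; near=> q.
- exact: bra_linear2.
Unshelve. all: by end_near. Qed.

Lemma tri_tensorial1 p (Y Z : sect 1%N) : U p -> section_at p Y ->
  section_at p Z -> tensorial_at p (fun X => tri X Y Z p).
Proof.
move=> Up gY gZ; split=> [s t gs gt st|f s t sf gs gt]; first exact: tri_eq.
exact: tri_linear.
Qed.

Lemma tri_tensorial2 p (X Z : sect 1%N) : U p -> section_at p X ->
  section_at p Z -> tensorial_at p (fun Y => tri X Y Z p).
Proof.
move=> Up gX gZ; apply: (tensorial_oppE (tri_tensorial1 Up gX gZ)) => s gs.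
exact: tri_skew12.
Qed.

Lemma tri_tensorial3 p (X Y : sect 1%N) : U p -> section_at p X ->
  section_at p Y -> tensorial_at p (fun Z => tri X Y Z p).
Proof.
move=> Up gX gY; apply: (tensorial_oppE (tri_tensorial2 Up gX gY)) => s gs.
exact: tri_skew23.
Qed.

Hypothesis Um : U m.

Lemma section_atE V k (x : gsec A) : open V -> V m -> hsec V k x ->
  section_at m (x k).
Proof. by move=> oV Vm [sx _]; exists V. Qed.

Lemma hsec_gsec_of_component V k (x : gsec A) : hsec V k x ->
  hsec V k (gsec_of (x k)).
Proof. by move=> [sx _]; exact: hsec_gsec_of. Qed.

Lemma brk2E V l (x y : gsec A) : open V -> V `<=` U -> V m ->
  hsec V 1 x -> hsec V l y -> la_brk [:: x; y] l m = bra (x 1%N) (y l) m.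
Proof.
move=> oV VU Vm hx hy.
apply: (@brk_local _ _ _ A V [:: 1%N; l] [:: x; y]
  [:: gsec_of (x 1%N); gsec_of (y l)]) => //.
- by split; [exact: hsec_gsec_of_component|split=> //];
    exact: hsec_gsec_of_component.
- by move=> [|[|j]] //=; exact: geq_gsec_of.
Qed.

Lemma brk3E V (x y z : gsec A) : open V -> V `<=` U -> V m ->
  hsec V 1 x -> hsec V 1 y -> hsec V 1 z ->
  la_brk [:: x; y; z] 2 m = tri (x 1%N) (y 1%N) (z 1%N) m.
Proof.
move=> oV VU Vm hx hy hz.
apply: (@brk_local _ _ _ A V [:: 1; 1; 1]%N [:: x; y; z]
  [:: gsec_of (x 1%N); gsec_of (y 1%N); gsec_of (z 1%N)]) => //.
- split; [|split; [|split=> //]]; exact: hsec_gsec_of_component.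
- by move=> [|[|[|j]]] //=; exact: geq_gsec_of.
Qed.

Lemma extends_cons V (xs : seq (gsec A)) v vs : extends (m := m) V xs (v :: vs) ->
  exists x xs', [/\ xs = x :: xs', hsec V (tag v) x,
    x (tag v) m = isoH_val (tagged v) & extends (m := m) V xs' vs].
Proof. by case: xs => [|x xs'] // [? ? ?]; exists x, xs'. Qed.

Lemma extends_nil V (xs : seq (gsec A)) : extends (m := m) V xs [::] -> xs = [::].
Proof. by case: xs. Qed.

(** [xget] yields a bracket computed with unspecified extensions; tensoriality at m replaces these
    by X and Y, one slot at a time. *)
Lemma iso_lieP (x y : isoH A m 1) (X Y : sect 1%N) :
  section_at m X -> section_at m Y -> X m = ker_val x -> Y m = ker_val y ->
  ker_val (iso_lie x y) = bra X Y m.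
Proof.
move=> gX gY Xx Yy.
have X0 : ac_rho A m (X m) = 0 by rewrite Xx; exact/eqP/(ker_valP x).
have Y0 : ac_rho A m (Y m) = 0 by rewrite Yy; exact/eqP/(ker_valP y).
have [V [oV Vm VU _ [hX hY _ _]]] :=
  brk_nbhd oU Um (P := fun=> True) filterT gX gY gX gX.
have k0 : bra X Y m \in ker_pred (ac_rho A m) by apply/eqP; exact: anchor_bra0.
rewrite /iso_lie /iso_bracket.
(* The set is inhabited, so [xget] selects one of its members instead of falling back on the default
   0. That the bracket lies in the kernel comes from [anchor_bra]. *)
set S := (S in xget _ S); have /(xgetPex 0) : exists w, S w.
  exists (Ker k0); exists V, [:: gsec_of X; gsec_of Y]; split => //=.
  by rewrite !gsec_of_id.
set w := xget _ _ => -[V' [xs [oV' V'U V'm]]].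
move=> /extends_cons[x1 [s1 [-> h1 x1x]]] /extends_cons[y1 [s2 [-> h2 y1y]]].
move=> /extends_nil -> /= ->.
rewrite (@brk2E V' 1)//.
have g1 := section_atE oV' V'm h1; have g2 := section_atE oV' V'm h2.
(* The second slot is exchanged while the first still holds [x1], whose value at m is killed by the
   anchor as well. *)
rewrite (@tensorial_eq _ _ _ _ _ _ (fun Y => bra (x1 1%N) Y m) (y1 1%N) Y Um)//;
  last by rewrite y1y Yy.
  apply: (@tensorial_eq _ _ _ _ _ _ (fun X => bra X Y m) (x1 1%N) X Um) => //.
    exact: bra_tensorial1.
  by rewrite x1x Xx.
by apply: bra_tensorialr => //; rewrite x1x; exact/eqP/(ker_valP x).
Qed.

Lemma iso_actP (x : isoH A m 1) (u : isoH A m 2) (X : sect 1%N) (Y : sect 2%N) :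
  section_at m X -> section_at m Y -> X m = ker_val x -> Y m = u ->
  iso_act x u = bra X Y m.
Proof.
move=> gX gY Xx Yu.
have X0 : ac_rho A m (X m) = 0 by rewrite Xx; exact/eqP/(ker_valP x).
have [V [oV Vm VU _ [hX hY _ _]]] :=
  brk_nbhd oU Um (P := fun=> True) filterT gX gY gX gX.
rewrite /iso_act /iso_bracket.
set S := (S in xget _ S); have /(xgetPex 0) : exists w, S w.
  exists (bra X Y m); exists V, [:: gsec_of X; gsec_of Y]; split => //=.
  by rewrite !gsec_of_id.
set w := xget _ _ => -[V' [xs [oV' V'U V'm]]].
move=> /extends_cons[x1 [s1 [-> h1 x1x]]] /extends_cons[y1 [s2 [-> h2 y1y]]].
move=> /extends_nil -> /= ->.
rewrite (@brk2E V' 2)//.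
have g1 := section_atE oV' V'm h1; have g2 := section_atE oV' V'm h2.
rewrite (@tensorial_eq _ _ _ _ _ _ (fun Y => bra (x1 1%N) Y m) (y1 2%N) Y Um)//;
  last by rewrite y1y Yu.
  apply: (@tensorial_eq _ _ _ _ _ _ (fun X => bra X Y m) (x1 1%N) X Um) => //.
    exact: bra_tensorial2.
  by rewrite x1x Xx.
by apply: bra_tensorialr => //; rewrite x1x; exact/eqP/(ker_valP x).
Qed.

Lemma iso_cochain3P (x y z : isoH A m 1) (X Y Z : sect 1%N) :
  section_at m X -> section_at m Y -> section_at m Z ->
  X m = ker_val x -> Y m = ker_val y -> Z m = ker_val z ->
  iso_cochain3 [:: x; y; z] = tri X Y Z m.
Proof.
move=> gX gY gZ Xx Yy Zz.
have [V [oV Vm VU _ [hX hY hZ _]]] :=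
  brk_nbhd oU Um (P := fun=> True) filterT gX gY gZ gX.
rewrite /iso_cochain3 /iso_bracket.
set S := (S in xget _ S); have /(xgetPex 0) : exists w, S w.
  exists (tri X Y Z m); exists V, [:: gsec_of X; gsec_of Y; gsec_of Z].
  by split => //=; rewrite !gsec_of_id.
set w := xget _ _ => -[V' [xs [oV' V'U V'm]]].
move=> /extends_cons[x1 [s1 [-> h1 x1x]]] /extends_cons[y1 [s2 [-> h2 y1y]]].
move=> /extends_cons[z1 [s3 [-> h3 z1z]]] /extends_nil -> /= ->.
rewrite (@brk3E V')//.
have g1 := section_atE oV' V'm h1; have g2 := section_atE oV' V'm h2.
have g3 := section_atE oV' V'm h3.
transitivity (tri X (y1 1%N) (z1 1%N) m).
  apply: (@tensorial_eq _ _ _ _ _ _ (fun X => tri X _ _ m) (x1 1%N) X Um) => //.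
    exact: tri_tensorial1.
  by rewrite x1x Xx.
transitivity (tri X Y (z1 1%N) m).
  apply: (@tensorial_eq _ _ _ _ _ _ (fun Y => tri X Y _ m) (y1 1%N) Y Um) => //.
    exact: tri_tensorial2.
  by rewrite y1y Yy.
apply: (@tensorial_eq _ _ _ _ _ _ (fun Z => tri X Y Z m) (z1 1%N) Z Um) => //.
  exact: tri_tensorial3.
by rewrite z1z Zz.
Qed.

Lemma ker_extension (x : isoH A m 1) : exists X : sect 1%N,
  [/\ section_at m X, X m = ker_val x & ac_rho A m (X m) = 0].
Proof.
have [X gX Xx] := section_extension (ker_val x) Um.
by exists X; split => //; rewrite Xx; exact/eqP/(ker_valP x).
Qed.

Lemma section_at_cstlin k (a : R) (X Y : sect k) :
  section_at m X -> section_at m Y ->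
  section_at m (fun q => a *: X q + Y q).
Proof. by apply: section_at_lin; exact: smooth_at_cst. Qed.

Lemma iso_lie_linl a (x y z : isoH A m 1) :
  iso_lie (a *: x + y) z = a *: iso_lie x z + iso_lie y z.
Proof.
have [X [gX Xx X0]] := ker_extension x; have [Y [gY Yy Y0]] := ker_extension y.
have [Z [gZ Zz Z0]] := ker_extension z; apply: val_inj.
rewrite [LHS](iso_lieP (section_at_cstlin a gX gY) gZ)//; last by rewrite Xx Yy.
rewrite [RHS]/= (iso_lieP gX gZ)// (iso_lieP gY gZ)//.
exact: (bra_tensorial1 Um gZ Z0).2 _ _ _ (smooth_at_cst _ _) gX gY.
Qed.

Lemma iso_lie_skew (x y : isoH A m 1) : iso_lie x y = - iso_lie y x.
Proof.
have [X [gX Xx X0]] := ker_extension x; have [Y [gY Yy Y0]] := ker_extension y.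
apply: val_inj; rewrite [LHS](iso_lieP gX gY)// [RHS]/= (iso_lieP gY gX)//.
exact: bra_skew.
Qed.

Lemma eqN_eq0 (V : lmodType R) (v : V) : v = - v -> v = 0.
Proof.
move=> vN; have /eqP : (2%:R : R) *: v = 0.
  by rewrite scaler_nat mulr2n {2}vN subrr.
by rewrite scaler_eq0 pnatr_eq0 => /eqP.
Qed.

Hypothesis Amin : minimal_at A m.

Lemma iso_lie_algebra : is_lie_algebra (@iso_lie _ _ _ A m).
Proof.
split.
- exact: iso_lie_linl.
- move=> a x y z; rewrite iso_lie_skew iso_lie_linl.
  by rewrite (iso_lie_skew x y) (iso_lie_skew x z) scalerN opprD.
- by move=> x; apply: eqN_eq0; exact: iso_lie_skew.
- move=> x y z.
  rewrite (iso_lie_skew x (iso_lie y z)) (iso_lie_skew y (iso_lie z x)).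
  rewrite (iso_lie_skew z (iso_lie x y)).
  have [X [gX Xx X0]] := ker_extension x; have [Y [gY Yy Y0]] := ker_extension y.
  have [Z [gZ Zz Z0]] := ker_extension z.
  have gXY := bra_section oU Um gX gY; have gXZ := bra_section oU Um gX gZ.
  have gYZ := bra_section oU Um gY gZ.
  have zx : iso_lie (iso_lie z x) y = - iso_lie (iso_lie x z) y.
    rewrite (iso_lie_skew z x) -scaleN1r -[_ *: _]addr0 iso_lie_linl.
    have /(congr1 (fun v => v - iso_lie 0 y)) := iso_lie_linl 1 0 0 y.
    rewrite scale1r addr0 scale1r addrK subrr => <-.
    by rewrite addr0 scaleN1r.
  apply: val_inj; rewrite zx /=.
  rewrite (iso_lieP (x := iso_lie y z) gYZ gX)//; last by symmetry; exact: iso_lieP.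
  rewrite (iso_lieP (x := iso_lie x z) gXZ gY)//; last by symmetry; exact: iso_lieP.
  rewrite (iso_lieP (x := iso_lie x y) gXY gZ)//; last by symmetry; exact: iso_lieP.
  have := bra_jacobi oU Um gX gY gZ; rewrite Amin// => J.
  by rewrite -[RHS]oppr0 -J; module_eq R.
Qed.

Lemma iso_lie_module : is_lie_module (@iso_lie _ _ _ A m) (@iso_act _ _ _ A m).
Proof.
split.
- move=> a x y v.
  have [X [gX Xx X0]] := ker_extension x; have [Y [gY Yy Y0]] := ker_extension y.
  have [V gV Vv] := section_extension v Um.
  rewrite (iso_actP (section_at_cstlin a gX gY) gV)//; last by rewrite Xx Yy.
  rewrite (iso_actP gX gV)// (iso_actP gY gV)//.
  exact: (bra_tensorial2 Um gV).2 _ _ _ (smooth_at_cst _ _) gX gY.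
- move=> a x v w; have [X [gX Xx X0]] := ker_extension x.
  have [V gV Vv] := section_extension v Um.
  have [W gW Ww] := section_extension w Um.
  rewrite (iso_actP gX (section_at_cstlin a gV gW))//; last by rewrite Vv Ww.
  rewrite (iso_actP gX gV)// (iso_actP gX gW)//.
  exact: (@bra_tensorialr m 2 X Um gX X0).2 _ _ _ (smooth_at_cst _ _) gV gW.
- move=> x y v.
  have [X [gX Xx X0]] := ker_extension x; have [Y [gY Yy Y0]] := ker_extension y.
  have [V gV Vv] := section_extension v Um.
  have gXY := bra_section oU Um gX gY; have gXV := bra_section oU Um gX gV.
  have gYV := bra_section oU Um gY gV; have gdV := dsec_section oU Um gV.
  rewrite (iso_actP (x := iso_lie x y) gXY gV)//; last by symmetry; exact: iso_lieP.
  rewrite (iso_actP (u := iso_act y v) gX gYV)//; last by rewrite (iso_actP gY gV).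
  rewrite (iso_actP (u := iso_act x v) gY gXV)//; last by rewrite (iso_actP gX gV).
  have [T] := bra_jacobi2 oU Um gX gY gV; rewrite Amin// addr0.
  (* dV vanishes at m by minimality and the ternary bracket is tensorial, so dV may be replaced by
     the zero section. *)
  rewrite (@tensorial_eq _ _ _ _ _ _ (fun Z => tri Z X Y m) (dsec V) (fun=> 0) Um);
    [|exact: tri_tensorial1|by []|exact: section_at0|exact: Amin].
  rewrite (tensorial0 (tri_tensorial1 Um gX gY)) => J.
  by rewrite -[RHS]addr0 -J; module_eq R.
Qed.

Lemma iso_cochain3_skew12 x y z :
  @iso_cochain3 _ _ _ A m [:: x; y; z] = - iso_cochain3 [:: y; x; z].
Proof.
have [X [gX Xx X0]] := ker_extension x; have [Y [gY Yy Y0]] := ker_extension y.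
have [Z [gZ Zz Z0]] := ker_extension z.
rewrite (iso_cochain3P gX gY gZ)// (iso_cochain3P gY gX gZ)//.
exact: tri_skew12.
Qed.

Lemma iso_cochain3_skew23 x y z :
  @iso_cochain3 _ _ _ A m [:: x; y; z] = - iso_cochain3 [:: x; z; y].
Proof.
have [X [gX Xx X0]] := ker_extension x; have [Y [gY Yy Y0]] := ker_extension y.
have [Z [gZ Zz Z0]] := ker_extension z.
rewrite (iso_cochain3P gX gY gZ)// (iso_cochain3P gX gZ gY)//.
exact: tri_skew23.
Qed.

Lemma iso_cochain3_linl a x x' y z :
  @iso_cochain3 _ _ _ A m [:: a *: x + x'; y; z] =
    a *: iso_cochain3 [:: x; y; z] + iso_cochain3 [:: x'; y; z].
Proof.
have [X [gX Xx X0]] := ker_extension x; have [Y [gY Yy Y0]] := ker_extension y.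
have [Z [gZ Zz Z0]] := ker_extension z.
have [X' [gX' Xx' _]] := ker_extension x'.
rewrite (iso_cochain3P (section_at_cstlin a gX gX') gY gZ)//;
  last by rewrite Xx Xx'.
rewrite (iso_cochain3P gX gY gZ)// (iso_cochain3P gX' gY gZ)//.
exact: tri_linear (smooth_at_cst _ _) _ _ _ _.
Qed.

Lemma iso_cochain3_multilinear : ce_cochain 3 (@iso_cochain3 _ _ _ A m).
Proof.
split.
- case=> [|s [|t [|? ?]]] [|u [|v [|? ?]]] a x y //= _.
  + exact: iso_cochain3_linl.
  + have sw := iso_cochain3_skew12.
    rewrite (sw s _ u) (sw s x u) (sw s y u) iso_cochain3_linl. module_eq R.
  + have sw := iso_cochain3_skew12; have sw' := iso_cochain3_skew23.
    rewrite (sw' s t _) (sw' s t x) (sw' s t y) (sw s _ t) (sw s x t) (sw s y t).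
    rewrite iso_cochain3_linl. module_eq R.
- case=> [|x [|y [|z [|? ?]]]] // _; rewrite /= !inE.
  have [<- _|_] := eqVneq x y.
    by apply: eqN_eq0; exact: iso_cochain3_skew12.
  (* Three adjacent transpositions exchange the outer slots, an odd permutation. *)
  have [<- _|_] := eqVneq x z.
    apply: eqN_eq0; rewrite {1}iso_cochain3_skew23 {1}iso_cochain3_skew12.
    by rewrite {1}iso_cochain3_skew23 !opprK.
  have [<- _|//] := eqVneq y z.
  by apply: eqN_eq0; exact: iso_cochain3_skew23.
Qed.

Lemma iso_ce_cocycle : ce_cocycle (@iso_lie _ _ _ A m) (@iso_act _ _ _ A m) 3
  (@iso_cochain3 _ _ _ A m).
Proof.
split; first exact: iso_cochain3_multilinear.
case=> [|x [|y [|z [|w [|? ?]]]]] // _.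
have [X [gX Xx X0]] := ker_extension x; have [Y [gY Yy Y0]] := ker_extension y.
have [Z [gZ Zz Z0]] := ker_extension z; have [W [gW Ww W0]] := ker_extension w.
have gXY := bra_section oU Um gX gY; have gXZ := bra_section oU Um gX gZ.
have gXW := bra_section oU Um gX gW; have gYZ := bra_section oU Um gY gZ.
have gYW := bra_section oU Um gY gW; have gZW := bra_section oU Um gZ gW.
have tXYZ := tri_section oU Um gX gY gZ; have tXYW := tri_section oU Um gX gY gW.
have tXZW := tri_section oU Um gX gZ gW; have tYZW := tri_section oU Um gY gZ gW.
have bE (a b : isoH A m 1) (S T : sect 1%N) : section_at m S -> section_at m T ->
    S m = ker_val a -> T m = ker_val b -> bra S T m = ker_val (iso_lie a b).
  by move=> *; symmetry; exact: iso_lieP.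
have wE (a b c : isoH A m 1) (S T T' : sect 1%N) : section_at m S ->
    section_at m T -> section_at m T' -> S m = ker_val a -> T m = ker_val b ->
    T' m = ker_val c -> tri S T T' m = iso_cochain3 [:: a; b; c].
  by move=> *; symmetry; exact: iso_cochain3P.
rewrite ce_diff4.
rewrite (iso_actP gX tYZW)//; last exact: wE.
rewrite (iso_actP gY tXZW)//; last exact: wE.
rewrite (iso_actP gZ tXYW)//; last exact: wE.
rewrite (iso_actP gW tXYZ)//; last exact: wE.
rewrite (iso_cochain3P gXY gZ gW)//; last exact: bE.
rewrite (iso_cochain3P gXZ gY gW)//; last exact: bE.
rewrite (iso_cochain3P gXW gY gZ)//; last exact: bE.
rewrite (iso_cochain3P gYZ gX gW)//; last exact: bE.
rewrite (iso_cochain3P gYW gX gZ)//; last exact: bE.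
rewrite (iso_cochain3P gZW gX gY)//; last exact: bE.
have [T] := tri_jacobi oU Um gX gY gZ gW; rewrite Amin// addr0 => J.
(* At m the Jacobi sum is minus the Chevalley-Eilenberg differential. *)
by rewrite -[RHS]oppr0 -J; module_eq R.
Qed.

End Isotropy.

(** * Comparison of resolutions *)

Section Exactness.
Variables (R : realType) (M : manifold R) (F : singular_foliation M).
Variables (U : set M) (C : anchored_bundles U).
Hypotheses (oU : open U) (resC : geometric_resolution F C).

Lemma nbhd_sections q k (s : forall p, C k p) (P : M -> Prop) : U q ->
  section_at q s -> (\near q, P q) ->
  exists V, [/\ open V, V q, V `<=` U, smooth_section V s & forall p, V p -> P p].
Proof.
move=> Uq /section_at_near gs nP.
have /(near_nbhd oU Uq)[V [oV Vq VU VP]] : \near q, P q /\ section_at q s.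
  by near=> p; split; near: p.
exists V; split => // [|p /VP[]//].
by apply: smooth_section_local => // p /VP[].
Unshelve. all: by end_near. Qed.

(* The map out of E_{-i} in the resolution; its codomain is TM for i = 1. *)
Definition target i p : lmodType R :=
  match i with
  | 0 => C 0%N p
  | 1 => tangent p
  | i'.+2 => C i'.+1 p
  end.

Definition boundary i p : {linear C i p -> target i p} :=
  match i return {linear C i p -> target i p} with
  | 0 => idfun
  | 1 => ac_rho C p
  | i'.+2 => ac_d C i'.+1 p
  end.

Lemma exact_lift i m (s : forall p, C i p) : (0 < i)%N -> U m ->
  section_at m s -> (\near m, boundary i m (s m) = 0) ->
  exists2 t : forall p, C i.+1 p, section_at m t &
    \near m, ac_d C i m (t m) = s m.
Proof.
move=> i0 Um gs s0; have [_ ex1 ex2] := resC.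
have [V [oV Vm VU ss s0V]] := nbhd_sections Um gs s0.
suff [W [oW Wm _ [t st dt]]] : exists W, [/\ open W, W m, W `<=` V &
    exists2 t : forall p, C i.+1 p, smooth_section W t &
      forall q, W q -> ac_d C i q (t q) = s q].
  exists t; first by exists W.
  by near=> q; apply: dt; near: q; exact: open_nbhs_nbhs.
case: i i0 s gs ss s0V {s0} => [|[|i]] // _ s gs ss s0V.
- by have [+ _] := ex1 V s oV VU ss; apply.
- by have [+ _] := ex2 i.+1 V s isT oV VU ss; apply.
Unshelve. all: by end_near. Qed.

(** Exactness is about sections, so even this fibrewise identity is obtained by extending x: the
    differential of the extension is locally exact, hence closed. *)
Lemma boundary_d i q (x : C i.+1 q) : (0 < i)%N -> U q ->
  boundary i q (ac_d C i q x) = 0.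
Proof.
move=> i0 Uq; have [_ ex1 ex2] := resC.
have [t gt <-] := section_extension x Uq.
have [V [oV Vq VU st _]] := nbhd_sections Uq gt (P := fun=> True) filterT.
have sd := (ac_d_smooth C i).2 V t oV VU st.
have loc : locally_on V (fun W => exists2 t' : forall p, C i.+1 p,
    smooth_section W t' &
    forall q, W q -> ac_d C i q (t' q) = ac_d C i q (t q)).
  by move=> p Vp; exists V; split => //; exists t.
case: i i0 x t gt st sd loc => [|[|i]] // _ x t gt st sd loc.
- by have [_ /(_ loc)] := ex1 V _ oV VU sd; exact.
- by have [_ /(_ loc)] := ex2 i.+1 V _ isT oV VU sd; exact.
Qed.

Lemma d_morphism i q : U q ->
  morphism_at (E := C i.+1) (E' := C i) q (fun p => ac_d C i p).
Proof. by move=> Uq; exists U; split => //; exact: ac_d_smooth. Qed.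

End Exactness.

Section Comparison.
Variables (R : realType) (M : manifold R) (F : singular_foliation M).
Variables (U U' : set M) (C : anchored_bundles U) (C' : anchored_bundles U').
Hypotheses (oU : open U) (oU' : open U').
Hypotheses (resC : geometric_resolution F C) (resC' : geometric_resolution F C').
Variable m : M.
Hypotheses (Um : U m) (U'm : U' m).

Let nU : \near m, U m. Proof. by apply: open_nbhs_nbhs. Qed.
Let nU' : \near m, U' m. Proof. by apply: open_nbhs_nbhs. Qed.

(** Here F links the two resolutions: the anchor of s is a section of F, hence lifts locally through
    the other anchor. *)
Lemma anchor_lift (s : forall p, C 1%N p) : section_at m s ->
  exists2 t : forall p, C' 1%N p, section_at m t &
    \near m, ac_rho C' m (t m) = ac_rho C m (s m).
Proof.
move=> gs; have [V [oV Vm VU ss VU']] := nbhd_sections oU Um gs nU'.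
have [sur _ _] := resC; have [sur' _ _] := resC'.
have /(sur' V _ oV VU')/(_ m Vm)[W [oW Wm _ [t st rt]]] :
    F V (fun p => ac_rho C p (s p)).
  by apply/(sur V _ oV VU) => p Vp; exists V; split => //; exists s.
exists t; first by exists W.
by near=> q; apply: rt; near: q; exact: open_nbhs_nbhs.
Unshelve. all: by end_near. Qed.

(** The induction invariant: the second clause is the closedness that [exact_lift] requires in order
    to produce the next component. *)
Definition chain_lift i (phi : forall p, C i p -> C' i p) :=
  morphism_at m phi /\
  \forall q \near m, forall x, boundary C' i q (phi q (ac_d C i q x)) = 0.

Lemma chain_lift1 : exists phi : forall p, C 1%N p -> C' 1%N p,
  chain_lift phi /\
  \forall q \near m, forall x, ac_rho C' q (phi q x) = ac_rho C q x.
Proof.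
have [|phi mphi rphi] := @morphism_lift _ _ _ _ (C 1%N) (C' 1%N) _
  (fun q => ac_rho C q) (fun q => ac_rho C' q) m Um oU' U'm _ anchor_lift.
  by near=> q => a x y; rewrite linearP.
exists phi; split => //; split => //; near=> q => x /=.
have Uq : U q by near: q.
rewrite (near rphi q)//; exact: (boundary_d oU resC (i := 1)).
Unshelve. all: by end_near. Qed.

Lemma chain_liftS i (phi : forall p, C i.+1 p -> C' i.+1 p) : chain_lift phi ->
  exists psi : forall p, C i.+2 p -> C' i.+2 p, chain_lift psi /\
  \forall q \near m, forall x, phi q (ac_d C i.+1 q x) = ac_d C' i.+1 q (psi q x).
Proof.
move=> [mphi cphi]; have nphi := morphism_at_near mphi.
have [||psi mpsi dpsi] := @morphism_lift _ _ _ _ (C i.+2) (C' i.+2) _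
  (fun q x => phi q (ac_d C i.+1 q x)) (fun q => ac_d C' i.+1 q) m Um oU' U'm.
- near=> q => a x y; rewrite linearP morphism_at_lin//; exact: (near nphi q).
- move=> s gs; apply: (exact_lift oU' resC') => //.
    apply: (morphism_at_section (phi := phi)) => //.
    exact: (morphism_at_section (phi := fun q => ac_d C i.+1 q)
      (d_morphism _ oU _ Um)).
  by near=> q; apply: (near cphi q).
exists psi; split; last by near=> q => x; rewrite (near dpsi q).
split=> //; near=> q => x /=.
rewrite (near dpsi q)//.
have -> : ac_d C i.+1 q (ac_d C i.+2 q x) = 0.
  by apply: (boundary_d oU resC (i := i.+2)) => //; near: q.
apply: morphism_at0; exact: (near nphi q).
Unshelve. all: by end_near. Qed.

Lemma comparison_exists : exists phi, comparison m (C := C) (C' := C') phi.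
Proof.
have [phi1 [c1 r1]] := chain_lift1.
(* Each component is chosen after the previous one, so the recursion carries the invariant along.
   Every component has its own neighbourhood of m. *)
pose P i := {phi : forall p, C i.+1 p -> C' i.+1 p | chain_lift phi}.
pose step i (phi : P i) := cid (chain_liftS (svalP phi)).
pose next i (phi : P i) : P i.+1 :=
  exist _ (sval (step i phi)) (svalP (step i phi)).1.
pose seq_phi := fix seq_phi i : P i :=
  if i is j.+1 then next j (seq_phi j) else exist _ phi1 c1.
(* Index 0 carries the zero bundle, which makes the chain relation between degrees -1 and 0
   automatic. *)
exists (fun i => if i is j.+1 return forall p, C i p -> C' i p
  then sval (seq_phi j) else fun p _ => 0).
split.
- case=> [|i]; last exact: (svalP (seq_phi i)).1.
  exists (U `&` U'); split => //; first exact: openI.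
  apply: bundle_morphismP => [p _ a x y|p s _ _]; last exact: section_at0.
  by rewrite scaler0 addr0.
- by have [V [oV Vm VP]] := near_open r1; exists V.
- case=> [|i].
    exists (U `&` U'); split => [||p [Up U'p] x]; [exact: openI|by []|].
    by rewrite [RHS](ac_bundle0 U'p).
  have [V [oV Vm VP]] := near_open (svalP (step i (seq_phi i))).2.
  by exists V.
Qed.

Lemma comparisonP phi : comparison m (C := C) (C' := C') phi ->
  [/\ forall i, morphism_at m (phi i),
    \forall q \near m, forall x, ac_rho C' q (phi 1%N q x) = ac_rho C q x &
    forall i, \forall q \near m, forall x,
      phi i q (ac_d C i q x) = ac_d C' i q (phi i.+1 q x)].
Proof.
have near_of (P : M -> Prop) :
    (exists W, [/\ open W, W m & forall p, W p -> P p]) -> \near m, P m.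
  move=> [W [oW Wm WP]]; near=> q; apply: WP; near: q; exact: open_nbhs_nbhs.
by move=> [mphi rphi dphi]; split => // [|i]; exact: near_of.
Unshelve. all: by end_near. Qed.

Hypotheses (minC : minimal_at C m) (minC' : minimal_at C' m).

(* Two comparisons are homotopic, and the homotopy contributes nothing at m. *)
Lemma comparison_unique phi psi :
  comparison m (C := C) (C' := C') phi -> comparison m (C := C) (C' := C') psi ->
  forall i x, phi i m x = psi i m x.
Proof.
move=> /comparisonP[mphi rphi dphi] /comparisonP[mpsi rpsi dpsi].
pose delta i q (x : C i q) := phi i q x - psi i q x.
have mdelta i : morphism_at m (@delta i) by exact: morphism_at_sub.
have ddelta i : \forall q \near m, forall x,
    delta i q (ac_d C i q x) = ac_d C' i q (delta i.+1 q x).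
  near=> q => x; rewrite /delta linearB.
  by rewrite (near (dphi i) q)// (near (dpsi i) q).
(* The homotopy relation is delta = d h + h' d, with h' the previous map. Composed with d it loses
   the term in h', so only the latest map and its relation on the image of d are remembered. At m
   both terms vanish by minimality. *)
have H i : (forall x, delta i.+1 m x = 0) /\
    exists2 h : forall q, C i.+1 q -> C' i.+2 q, morphism_at m h &
      \forall q \near m, forall x, delta i.+1 q (ac_d C i.+1 q x) =
        ac_d C' i.+1 q (h q (ac_d C i.+1 q x)).
  elim: i => [|i [_ [h mh hd]]].
    have ndelta := morphism_at_near (mdelta 1%N).
    have [||h mh dh] := @morphism_lift _ _ _ _ (C 1%N) (C' 2%N) _
      (fun q x => delta 1%N q x) (fun q => ac_d C' 1 q) m Um oU' U'm.
    - by near=> q => a x y; rewrite morphism_at_lin//; exact: (near ndelta q).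
    - move=> s gs; apply: (exact_lift oU' resC') => //.
        exact: (morphism_at_section (phi := @delta 1%N)).
      near=> q; rewrite /= /delta linearB /=.
      by rewrite (near rphi q)// (near rpsi q)// subrr.
    split; first by move=> x; rewrite -(nbhs_singleton dh) minC'.
    by exists h => //; near=> q => x; rewrite (near dh q).
  have nh := morphism_at_near mh.
  pose f q x := delta i.+2 q x - h q (ac_d C i.+1 q x).
  have mhd : morphism_at m (fun q x => h q (ac_d C i.+1 q x)).
    exact: (morphism_at_comp (d_morphism C oU i.+1 Um) mh).
  have mf : morphism_at m f by exact: morphism_at_sub (mdelta i.+2) mhd.
  have nf := morphism_at_near mf.
  have [||h' mh' dh'] := @morphism_lift _ _ _ _ (C i.+2) (C' i.+3) _
      f (fun q => ac_d C' i.+2 q) m Um oU' U'm.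
  - by near=> q => a x y; rewrite morphism_at_lin//; exact: (near nf q).
  - move=> s gs; apply: (exact_lift oU' resC') => //.
      exact: (morphism_at_section (phi := f)).
    near=> q; rewrite /= /f linearB /=.
    by rewrite -(near (ddelta i.+1) q)// (near hd q)// subrr.
  split.
    move=> x; have := nbhs_singleton dh' x; rewrite minC'// /f minC//.
    by rewrite (morphism_at0 mh) subr0 => <-.
  exists h' => //; near=> q => x; rewrite (near dh' q)// /f.
  have -> : ac_d C i.+1 q (ac_d C i.+2 q x) = 0.
    by apply: (boundary_d oU resC (i := i.+2)) => //; near: q.
  by rewrite morphism_at0 ?subr0//; exact: (near nh q).
case=> [|i] x; last by apply/eqP; rewrite -subr_eq0; apply/eqP; exact: (H i).1.
by rewrite [LHS](ac_bundle0 U'm) [RHS](ac_bundle0 U'm).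
Unshelve. all: by end_near. Qed.

End Comparison.

(** * Composition of comparisons and the canonical isomorphism *)

Section ComparisonAlgebra.
Variables (R : realType) (M : manifold R) (m : M).

Lemma comparisonI (U U' : set M) (C : anchored_bundles U)
    (C' : anchored_bundles U') (phi : forall i p, C i p -> C' i p) :
  (forall i, morphism_at m (phi i)) ->
  (\forall q \near m, forall x, ac_rho C' q (phi 1%N q x) = ac_rho C q x) ->
  (forall i, \forall q \near m, forall x,
    phi i q (ac_d C i q x) = ac_d C' i q (phi i.+1 q x)) ->
  comparison m (C := C) (C' := C') phi.
Proof.
move=> mphi rphi dphi; split => //.
- by have [V [oV Vm VP]] := near_open rphi; exists V.
- by move=> i; have [V [oV Vm VP]] := near_open (dphi i); exists V.
Qed.

Lemma comparison_id (U : set M) (C : anchored_bundles U) : open U -> U m ->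
  comparison m (C := C) (C' := C) (fun i p => id).
Proof.
move=> oU Um; apply: comparisonI => [i||i].
- exact: morphism_at_id.
- by near=> q.
- by near=> q.
Unshelve. all: by end_near. Qed.

Lemma comparison_comp (U1 U2 U3 : set M) (C1 : anchored_bundles U1)
    (C2 : anchored_bundles U2) (C3 : anchored_bundles U3)
    (phi : forall i p, C1 i p -> C2 i p) (psi : forall i p, C2 i p -> C3 i p) :
  comparison m (C := C1) (C' := C2) phi ->
  comparison m (C := C2) (C' := C3) psi ->
  comparison m (C := C1) (C' := C3) (fun i p => psi i p \o phi i p).
Proof.
move=> /comparisonP[mphi rphi dphi] /comparisonP[mpsi rpsi dpsi].
apply: comparisonI => [i||i].
- exact: morphism_at_comp.
- by near=> q => x /=; rewrite (near rpsi q)// (near rphi q).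
- by near=> q => x /=; rewrite (near (dphi i) q)// (near (dpsi i) q).
Unshelve. all: by end_near. Qed.

Lemma isoH_val_inj (U : set M) (A : lie_infty_algebroid U) i :
  injective (@isoH_val _ _ _ A m i).
Proof. by case: i => [|[|i]] // x y; exact: val_inj. Qed.

Lemma comparison_isoH (U U' : set M) (A : lie_infty_algebroid U)
    (A' : lie_infty_algebroid U') (phi : forall i p, A i p -> A' i p) :
  comparison m (C := A) (C' := A') phi ->
  exists tau : forall i, isoH A m i -> isoH A' m i,
    forall i v, isoH_val (tau i v) = phi i m (isoH_val v).
Proof.
move=> /comparisonP[_ rphi _].
have H i (v : isoH A m i) : exists w : isoH A' m i,
    isoH_val w = phi i m (isoH_val v).
  case: i v => [v|[v|i v]]; [by exists (phi 0%N m v)| |by exists (phi i.+2 m v)].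
  have k : phi 1%N m (ker_val v) \in ker_pred (ac_rho A' m).
    by apply/eqP; rewrite (nbhs_singleton rphi); exact/eqP/(ker_valP v).
  by exists (Ker k).
by exists (fun i v => sval (cid (H i v))) => i v; exact: svalP (cid (H i v)).
Qed.

(** With comparisons in both directions, each composite and the identity are two comparisons of a
    resolution with itself, hence agree at m. *)
Lemma canonical_iso_exists (F : singular_foliation M) (U U' : set M)
    (A : lie_infty_algebroid U) (A' : lie_infty_algebroid U') :
  open U -> open U' -> U m -> U' m -> universal F A -> universal F A' ->
  minimal_at A m -> minimal_at A' m ->
  exists tau : forall i, isoH A m i -> isoH A' m i, canonical_iso tau.
Proof.
move=> oU oU' Um U'm resA resA' minA minA'.
have [phi cphi] := comparison_exists oU oU' resA resA' Um U'm.
have [psi cpsi] := comparison_exists oU' oU resA' resA U'm Um.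
have [tau tauE] := comparison_isoH cphi.
have [sig sigE] := comparison_isoH cpsi.
exists tau; split; first by exists phi.
- move=> phi' cphi' i v; rewrite tauE.
  exact: (comparison_unique oU oU' resA resA' Um U'm minA minA').
- move=> i; exists (sig i) => v; apply: isoH_val_inj; rewrite !(tauE, sigE).
  + exact: (comparison_unique oU oU resA resA Um Um minA minA
      (comparison_comp cphi cpsi) (comparison_id _ oU Um)).
  + exact: (comparison_unique oU' oU' resA' resA' U'm U'm minA' minA'
      (comparison_comp cpsi cphi) (comparison_id _ oU' U'm)).
Qed.

End ComparisonAlgebra.

Section TangentValues.
Variables (R : realType) (M : manifold R) (p : M).

Lemma tangentB (u v : tangent p) f : (u - v : tangent p) f = u f - v f.
Proof. by []. Qed.

Lemma tangent_near (v : tangent p) f g : smooth_at p f ->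
  (\near p, f p = g p) -> v f = v g.
Proof. by move=> sf fg; have /asboolP[+ _ _ _] := valP v; exact. Qed.

Lemma tangent_cst1 (v : tangent p) : v (fun=> 1) = 0.
Proof.
have s1 := smooth_at_cst p (1 : R).
have /asboolP[_ _ /(_ _ _ s1 s1) + _] := valP v.
have -> : (fun q : M => (1 : R) * 1) = fun=> 1 by apply/funext => q; rewrite mulr1.
rewrite !mul1r => /(congr1 (fun x => x - val v (fun=> 1))).
by rewrite addrK subrr => <-.
Qed.

End TangentValues.

(** * Comparison of the brackets *)

Section BracketComparison.
Variables (R : realType) (M : manifold R) (F : singular_foliation M) (m : M).
Variables (U U' : set M) (A : lie_infty_algebroid U).
Variable (A' : lie_infty_algebroid U').
Hypotheses (oU : open U) (oU' : open U') (Um : U m) (U'm : U' m).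
Hypotheses (resA' : universal F A').
Hypotheses (minA : minimal_at A m) (minA' : minimal_at A' m).
Variable phi : forall i p, A i p -> A' i p.
Hypothesis cphi : comparison m (C := A) (C' := A') phi.

Local Notation sect k := (forall q, A k q).

Definition push i (X : sect i) : forall q, A' i q := fun q => phi (X q).

(** The anchor relation is demanded on a neighbourhood because it gets differentiated; the relation
    with d is pointwise and is spread out, where necessary, by asking for [good] nearby. *)
Definition good q := [/\ U q /\ U' q, morphism_at q (@phi 1%N),
  morphism_at q (@phi 2%N),
  (\forall q' \near q, forall x, ac_rho A' q' (@phi 1%N q' x) = ac_rho A q' x) &
  forall x, @phi 1%N q (ac_d A 1 q x) = ac_d A' 1 q (@phi 2%N q x)].

Lemma near_good : \forall q \near m, good q.
Proof.
have [mphi rphi dphi] := comparisonP cphi.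
have n1 := morphism_at_near (mphi 1%N); have n2 := morphism_at_near (mphi 2%N).
have nU : \near m, U m by apply: open_nbhs_nbhs.
have nU' : \near m, U' m by apply: open_nbhs_nbhs.
have nr := near_bump rphi; have nd := dphi 1%N.
by near=> q; split; [split|..]; near: q.
Unshelve. all: by end_near. Qed.

Let good_m : good m. Proof. exact: nbhs_singleton near_good. Qed.

Lemma push_section i q (X : sect i) : morphism_at q (@phi i) -> section_at q X ->
  section_at q (push X).
Proof. by move=> mq gX; apply: (morphism_at_section (phi := @phi i)). Qed.

Lemma push_near_lin q f (X Y : sect 1%N) : morphism_at q (@phi 1%N) ->
 \near q, push (fun q => f q *: X q + Y q) q = f q *: push X q + push Y q.
Proof.
move=> /morphism_at_near nq; near=> r.
exact: morphism_at_lin (near nq r _) _ _ _.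
Unshelve. all: by end_near. Qed.

Definition defect (X Y : sect 1%N) : forall q, A' 1%N q :=
  fun q => phi (bra X Y q) - bra (push X) (push Y) q.

Lemma defect_section q X Y : good q -> section_at q X -> section_at q Y ->
  section_at q (defect X Y).
Proof.
move=> [[Uq U'q] m1 m2 _ _] gX gY; apply: section_atB.
  by apply: push_section => //; exact: bra_section.
by apply: bra_section => //; exact: push_section.
Qed.

Lemma defect_skew q X Y : good q -> section_at q X -> section_at q Y ->
  defect X Y q = - defect Y X q.
Proof.
move=> [[Uq U'q] m1 m2 _ _] gX gY; rewrite /defect (bra_skew oU Uq gX gY).
have gX' := push_section m1 gX; have gY' := push_section m1 gY.
rewrite (bra_skew oU' U'q gX' gY') morphism_atN//; module_eq R.
Qed.

(** Both brackets produce the same anchor term, since phi preserves the anchors, and the two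
    cancel. *)
Lemma defect_tensorialr q X : good q -> section_at q X ->
  tensorial_at q (fun Y => defect X Y q).
Proof.
move=> [[Uq U'q] m1 m2 rq _] gX; have gX' := push_section m1 gX.
split=> [s t gs gt st|f s t sf gs gt]; rewrite /defect.
  rewrite (@bra_eq _ _ _ A oU q 1%N X X s t)//; last by near=> r.
  congr (_ - _); apply: bra_eq => //; try exact: push_section.
    by near=> r.
  by near=> r; rewrite /push (near st r).
have gs' := push_section m1 gs; have gt' := push_section m1 gt.
rewrite (@bra_eq _ _ _ A' oU' q 1%N (push X) (push X) _
  (fun r => f r *: push s r + push t r))//; first last.
- exact: push_near_lin.
- by near=> r.
- exact: section_at_lin.
- by apply: push_section => //; exact: section_at_lin.
rewrite !bra_leibniz// !(morphism_atD _ _ m1) !(morphism_atZ _ _ m1).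
have -> : anchor_app (push X) f q = anchor_app X f q.
  by rewrite /anchor_app (nbhs_singleton rq).
rewrite -/(push s q); module_eq R.
Unshelve. all: by end_near. Qed.

Lemma defect_tensoriall q Y : good q -> section_at q Y ->
  tensorial_at q (fun X => defect X Y q).
Proof.
move=> gq gY; apply: (tensorial_oppE (defect_tensorialr gq gY)) => X gX.
exact: defect_skew.
Qed.

(** By [anchor_bra] on either side, both brackets have as anchor the commutator of the same two
    vector fields. *)
Lemma defect_anchor q X Y : good q -> section_at q X -> section_at q Y ->
  ac_rho A' q (defect X Y q) = 0.
Proof.
move=> [[Uq U'q] m1 m2 rq _] gX gY.
have gX' := push_section m1 gX; have gY' := push_section m1 gY.
apply: tangent_eq0 => f sf; rewrite /defect linearB tangentB.
rewrite (nbhs_singleton rq) -[X in X - _]/(anchor_app (bra X Y) f q).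
rewrite -[X in _ - X]/(anchor_app (bra (push X) (push Y)) f q).
rewrite !anchor_bra//.
have anE Z : \near q, anchor_app (push Z) f q = anchor_app Z f q.
  by near=> r; rewrite /anchor_app /push (near rq r).
have appE Z T : section_at q T ->
    anchor_app (push Z) (anchor_app (push T) f) q
      = anchor_app Z (anchor_app T f) q.
  move=> gT; rewrite {1 3}/anchor_app (nbhs_singleton rq).
  apply: tangent_near (anE T); apply: anchor_app_smooth => //.
  exact: push_section.
by rewrite !appE// subrr.
Unshelve. all: by end_near. Qed.

Lemma closed_eq0 i (s : forall q, A' i q) : (0 < i)%N -> section_at m s ->
  (\near m, boundary A' i m (s m) = 0) -> s m = 0.
Proof.
move=> i0 gs s0; have [t gt dt] := exact_lift oU' resA' i0 U'm gs s0.
by rewrite -(nbhs_singleton dt) minA'.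
Qed.

Lemma defect_exact X Y : section_at m X -> section_at m Y ->
  exists2 t : forall q, A' 2%N q, section_at m t &
   \near m, ac_d A' 1 m (t m) = defect X Y m.
Proof.
move=> gX gY; apply: (exact_lift oU' resA' (i := 1) isT U'm).
  exact: defect_section.
have nX := section_at_near gX; have nY := section_at_near gY; have nG := near_good.
by near=> q; apply: defect_anchor; near: q.
Unshelve. all: by end_near. Qed.

(** Near m the binary bracket is preserved only up to a boundary; at m minimality makes phi a strict
    morphism. *)
Lemma defect_eq0 X Y : section_at m X -> section_at m Y -> defect X Y m = 0.
Proof.
move=> gX gY; have [t gt dt] := defect_exact gX gY.
by rewrite -(nbhs_singleton dt) minA'.
Qed.

(* The binary component of a morphism of Lie infinity-algebroids over phi. *)
Lemma defect_primitive : exists Phi : forall q, A 1%N q -> A 1%N q -> A' 2%N q,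
  [/\ \forall q \near m, forall a x y z,
        Phi q (a *: x + y) z = a *: Phi q x z + Phi q y z,
      \forall q \near m, forall x y, Phi q x y = - Phi q y x,
      \forall q \near m, forall X Y : sect 1%N, section_at q X -> section_at q Y ->
        section_at q (fun r => Phi r (X r) (Y r)) &
      \forall q \near m, forall X Y : sect 1%N, section_at q X -> section_at q Y ->
        ac_d A' 1 q (Phi q (X q) (Y q)) = defect X Y q].
Proof.
have [W [Wm [b]]] := frame_exists (A 1%N) Um; have oW := fr_open b.
have be j := fr_vec_at b j Wm.
have /boolp.choice[t tP] : forall jk : 'I_(fr_rank b) * 'I_(fr_rank b),
    exists t : forall q, A' 2%N q, section_at m t /\
     \near m, ac_d A' 1 m (t m) = defect (fr_vec b jk.1) (fr_vec b jk.2) m.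
  by move=> [j k]; have [t gt dt] := defect_exact (be j) (be k); exists t.
(* The lifts [t] are chosen independently and need not be skew. Their skew part still lifts the
   defect, which is itself skew. *)
pose s j k q : A' 2%N q := 2^-1 *: (t (j, k) q - t (k, j) q).
pose Phi q (x y : A 1%N q) : A' 2%N q :=
  \sum_j \sum_k (fr_coef b j x * fr_coef b k y) *: s j k q.
have gt1 : \forall q \near m, forall jk, section_at q (t jk).
  by apply: filter_forall => jk; apply: section_at_near; exact: (tP jk).1.
have gt2 : \forall q \near m, forall jk, ac_d A' 1 q (t jk q) =
    defect (fr_vec b jk.1) (fr_vec b jk.2) q.
  by apply: filter_forall => jk; exact: (tP jk).2.
have nW : \near m, W m by apply: open_nbhs_nbhs.
have nG := near_good.
exists Phi; split.
- near=> q => a x y z; rewrite /Phi scaler_sumr -big_split /=.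
  apply: eq_bigr => j _; rewrite scaler_sumr -big_split /=.
  apply: eq_bigr => k _; rewrite fr_coef_lin; last by near: q.
  module_eq R.
- near=> q => x y; rewrite /Phi exchange_big -sumrN /=.
  apply: eq_bigr => j _; rewrite -sumrN; apply: eq_bigr => k _.
  by rewrite /s mulrC; module_eq R.
- near=> q => X Y gX gY; have Wq : W q by near: q.
  have gtq := near gt1 q.
  have gs j k : section_at q (s j k).
    apply: section_atZ; first exact: smooth_at_cst.
    by apply: section_atB; apply: gtq.
  have gk j : section_at q (fun r => \sum_k
      (fr_coef b j (X r) * fr_coef b k (Y r)) *: s j k r).
    apply: (@section_at_sum _ _ _ _ q _ _
      (fun k r => fr_coef b j (X r) * fr_coef b k (Y r))) => // k.
    by apply: smooth_atM; exact: fr_coef_at.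
  have := @section_at_sum _ _ _ _ q _ (index_enum _) (fun _ _ => 1) _
    (fun=> smooth_at_cst q 1) gk.
  congr section_at; apply: functional_extensionality_dep => r.
  by apply: eq_bigr => j _; rewrite scale1r.
- near=> q => X Y gX gY; have Wq : W q by near: q.
  have gq : good q by near: q.
  have eq_ j := fr_vec_at b j Wq.
  rewrite (tensorial_frame b Wq (defect_tensoriall gq gY) gX) /Phi linear_sum.
  apply: eq_bigr => j _.
  rewrite (tensorial_frame b Wq (defect_tensorialr gq (eq_ j)) gY) linear_sum.
  rewrite scaler_sumr; apply: eq_bigr => k _.
  rewrite !linearZ linearB /= !(near gt2 q)//=.
  rewrite (defect_skew gq (eq_ k) (eq_ j)) opprK scalerA scalerDr -scalerDl.
  have half : 2^-1 + 2^-1 = 1 :> R by rewrite [RHS]splitr !mul1r.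
  by rewrite -mulrDr half mulr1; module_eq R.
Unshelve. all: by end_near. Qed.

(** The Leibniz rule for the constant function 1, which derivations kill. *)
Lemma bra_addr q l (X : forall p, A' 1%N p) (Y Z : forall p, A' l p) : U' q ->
  section_at q X -> section_at q Y -> section_at q Z ->
  bra X (fun p => Y p + Z p) q = bra X Y q + bra X Z q.
Proof.
move=> U'q gX gY gZ.
have := bra_leibniz oU' U'q (smooth_at_cst q 1) gX gY gZ.
rewrite /anchor_app tangent_cst1 scale0r addr0 scale1r => <-.
congr (bra X _ q); apply: functional_extensionality_dep => p.
by rewrite scale1r.
Qed.

Lemma bra_subr q l (X : forall p, A' 1%N p) (Y Z : forall p, A' l p) : U' q ->
  section_at q X -> section_at q Y -> section_at q Z ->
  bra X (fun p => Y p - Z p) q = bra X Y q - bra X Z q.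
Proof.
move=> U'q gX gY gZ; apply/eqP; rewrite eq_sym subr_eq; apply/eqP.
rewrite -bra_addr//; last exact: section_atB.
congr (bra X _ q); apply: functional_extensionality_dep => p.
by rewrite subrK.
Qed.

Lemma push_d (q : M) (Y : sect 2%N) : (\forall r \near q, good r) ->
  \forall r \near q, push (dsec Y) r = dsec (push Y) r.
Proof.
move=> ng; near=> r; have [_ _ _ _ dr] : good r by near: r.
exact: dr.
Unshelve. all: by end_near. Qed.

(** d is a derivation of both brackets and commutes with phi. *)
Lemma d_push_bra (q : M) (X : sect 1%N) (Y : sect 2%N) :
  (\forall r \near q, good r) ->
  section_at q X -> section_at q Y ->
  ac_d A' 1 q (phi (bra X Y q) - bra (push X) (push Y) q) = defect X (dsec Y) q.
Proof.
move=> ng gX gY; have [[Uq U'q] m1 m2 _ dq] := nbhs_singleton ng.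
have gX' := push_section m1 gX; have gY' := push_section m2 gY.
rewrite linearB /= -dq !bra_d// /defect; congr (_ - _).
apply: bra_eq => //; try exact: dsec_section.
- by apply: push_section => //; exact: dsec_section.
- by near=> r.
- by near=> r; symmetry; near: r; exact: push_d.
Unshelve. all: by end_near. Qed.

Section WithPrimitive.
Variable Phi : forall q, A 1%N q -> A 1%N q -> A' 2%N q.
Hypothesis Phi_linl : \forall q \near m, forall a x y z,
  @Phi q (a *: x + y) z = a *: @Phi q x z + @Phi q y z.
Hypothesis Phi_skew : \forall q \near m, forall x y, @Phi q x y = - @Phi q y x.
Hypothesis Phi_section : \forall q \near m, forall X Y : sect 1%N,
  section_at q X -> section_at q Y -> section_at q (fun r => Phi (X r) (Y r)).
Hypothesis Phi_d : \forall q \near m, forall X Y : sect 1%N,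
  section_at q X -> section_at q Y ->
  ac_d A' 1 q (Phi (X q) (Y q)) = defect X Y q.

Lemma primitive0 x : @Phi m x 0 = 0.
Proof.
rewrite (nbhs_singleton Phi_skew).
have := nbhs_singleton Phi_linl 1 0 0 x; rewrite !scale1r addr0.
move/(congr1 (fun u => u - @Phi m 0 x)); rewrite addrK subrr => <-.
by rewrite oppr0.
Qed.

Lemma push_bra2 (X : sect 1%N) (Y : sect 2%N) :
  section_at m X -> section_at m Y ->
  phi (bra X Y m) = bra (push X) (push Y) m.
Proof.
move=> gX gY; have nG := near_good.
have [[_ _] m1 m2 _ _] := good_m.
have gX' := push_section m1 gX; have gY' := push_section m2 gY.
have gdY := dsec_section oU Um gY.
pose K q := phi (bra X Y q) - bra (push X) (push Y) q - Phi (X q) (dsec Y q).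
have : K m = 0.
  apply: (closed_eq0 (i := 2)) => //.
    apply: section_atB.
      apply: section_atB; last exact: bra_section.
      by apply: push_section => //; exact: bra_section.
    exact: (nbhs_singleton Phi_section).
  have nX := section_at_near gX; have nY := section_at_near gY.
  have nG' := near_bump nG; have ndY := section_at_near gdY.
  near=> q; rewrite /K linearB /= d_push_bra; [|by near: q..].
  by rewrite (near Phi_d q)// ?subrr//; near: q.
rewrite /K [dsec Y m]minA// primitive0 subr0 => /eqP.
by rewrite subr_eq0 => /eqP.
Unshelve. all: by end_near. Qed.

(** The part of the Chevalley-Eilenberg differential of Phi in which Z is singled out. The signed
    sum over the three choices is the whole differential once evaluated at m. *)
Definition correction (X Y Z : sect 1%N) : forall q, A' 2%N q := fun q =>
  bra (push Z) (fun r => Phi (X r) (Y r)) q - Phi (bra X Y q) (Z q).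

Lemma correction_section X Y Z : section_at m X -> section_at m Y ->
  section_at m Z -> section_at m (correction X Y Z).
Proof.
move=> gX gY gZ; have [[_ _] m1 m2 _ _] := good_m.
have Ps := nbhs_singleton Phi_section.
apply: section_atB; last by apply: Ps => //; exact: bra_section.
by apply: bra_section => //; [exact: push_section|exact: Ps].
Qed.

(** Applying d replaces Phi by the defect. The two mixed terms pairing phi [X, Y] with phi Z cancel
    by skewness, which leaves nested brackets to which the Jacobi identities apply. *)
Lemma correction_d X Y Z : section_at m X -> section_at m Y ->
  section_at m Z -> \forall q \near m, ac_d A' 1 q (correction X Y Z q) =
    bra (bra (push X) (push Y)) (push Z) q - phi (bra (bra X Y) Z q).
Proof.
move=> gX gY gZ.
have nX := section_at_near gX; have nY := section_at_near gY.
have nZ := section_at_near gZ; have nG := near_good.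
have nPd := near_bump Phi_d.
near=> q; have gq : good q by near: q.
have [[Uq U'q] m1 m2 _ _] := gq.
have [qX qY qZ] : [/\ section_at q X, section_at q Y & section_at q Z].
  by split; near: q.
have qX' := push_section m1 qX; have qY' := push_section m1 qY.
have qZ' := push_section m1 qZ.
have qXY := bra_section oU Uq qX qY; have qXY' := bra_section oU' U'q qX' qY'.
have pXY := push_section m1 qXY.
have gP : section_at q (fun r => Phi (X r) (Y r)).
  by apply: (near Phi_section q).
rewrite /correction linearB /= bra_d//.
rewrite (near Phi_d q _ (bra X Y) Z qXY qZ)//.
have pd : \forall r \near q, ac_d A' 1 r (Phi (X r) (Y r)) = defect X Y r.
  have rX := section_at_near qX; have rY := section_at_near qY.
  have nP : \forall r \near q, forall X Y : sect 1%N,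
    section_at r X -> section_at r Y ->
    ac_d A' 1 r (Phi (X r) (Y r)) = defect X Y r by near: q.
  by near=> r; apply: (near nP r) => //; near: r.
have -> : bra (push Z) (dsec (fun r => Phi (X r) (Y r))) q =
    bra (push Z) (defect X Y) q.
  apply: bra_eq => //; [exact: dsec_section|exact: defect_section|].
  by near=> r.
rewrite /defect bra_subr// (bra_skew oU' U'q qXY' qZ') (bra_skew oU' U'q pXY qZ').
rewrite -/(push (bra X Y)); module_eq R.
Unshelve. all: by end_near. Qed.

(** The difference of the two sides is closed: phi of the Jacobi identity of [A] and the Jacobi
    identity of [A'] account for all nested brackets. *)
Lemma push_tri X Y Z : section_at m X -> section_at m Y -> section_at m Z ->
  phi (tri X Y Z m) - tri (push X) (push Y) (push Z) m =
    correction X Y Z m - correction X Z Y m + correction Y Z X m.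
Proof.
move=> gX gY gZ; have [[_ _] m1 m2 _ _] := good_m.
have gX' := push_section m1 gX; have gY' := push_section m1 gY.
have gZ' := push_section m1 gZ.
pose K q := phi (tri X Y Z q) - tri (push X) (push Y) (push Z) q -
  (correction X Y Z q - correction X Z Y q + correction Y Z X q).
suff /eqP : K m = 0 by rewrite subr_eq0 => /eqP.
apply: (closed_eq0 (i := 2)) => //.
  apply: section_atB.
    apply: section_atB; last exact: tri_section.
    by apply: push_section => //; exact: tri_section.
  apply: section_atD; last exact: correction_section.
  by apply: section_atB; exact: correction_section.
have c1 := correction_d gX gY gZ; have c2 := correction_d gX gZ gY.
have c3 := correction_d gY gZ gX.
have nX := section_at_near gX; have nY := section_at_near gY.
have nZ := section_at_near gZ; have nG := near_good.
near=> q; have gq : good q by near: q.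
have [[Uq U'q] mq _ _ dq] := gq.
have [qX qY qZ] : [/\ section_at q X, section_at q Y & section_at q Z].
  by split; near: q.
have qX' := push_section mq qX; have qY' := push_section mq qY.
have qZ' := push_section mq qZ.
rewrite /K /= linearB linearB linearD linearB /= -dq.
rewrite (near c1 q)// (near c2 q)// (near c3 q)//.
have J := bra_jacobi oU Uq qX qY qZ.
have J' := bra_jacobi oU' U'q qX' qY' qZ'.
have {}J : phi (bra (bra X Y) Z q) - phi (bra (bra X Z) Y q)
    + phi (bra (bra Y Z) X q) + phi (ac_d A 1 q (tri X Y Z q)) = 0.
  rewrite -(morphism_at0 mq) -J (morphism_atD _ _ mq) (morphism_atD _ _ mq).
  by rewrite (morphism_atB _ _ mq).
by rewrite -[RHS](subrr 0) -{1}J -J'; module_eq R.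
Unshelve. all: by end_near. Qed.

End WithPrimitive.
End BracketComparison.

(** * The induced isomorphism and the isotropy brackets *)

Section IsotropyComparison.
Variables (R : realType) (M : manifold R) (F : singular_foliation M) (m : M).
Variables (U U' : set M) (A : lie_infty_algebroid U).
Variable (A' : lie_infty_algebroid U').
Hypotheses (oU : open U) (oU' : open U') (Um : U m) (U'm : U' m).
Hypotheses (resA' : universal F A').
Hypotheses (minA : minimal_at A m) (minA' : minimal_at A' m).
Variable phi : forall i p, A i p -> A' i p.
Hypothesis cphi : comparison m (C := A) (C' := A') phi.
Variable tau : forall i, isoH A m i -> isoH A' m i.
Hypothesis tauE : forall i v, isoH_val (tau v) = phi (isoH_val v) :> A' i m.

Local Notation sect k := (forall q, A k q).

Lemma push_at i (X : sect i) (v : isoH A m i) : section_at m X ->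
  X m = isoH_val v ->
  section_at m (push phi X) /\ push phi X m = isoH_val (tau v).
Proof.
move=> gX Xv; have [mphi _ _] := comparisonP cphi.
by split; [exact: push_section|rewrite tauE /push Xv].
Qed.

Lemma tau_lie (x y : isoH A m 1) :
  tau (iso_lie x y) = iso_lie (tau x : isoH A' m 1) (tau y).
Proof.
have [X [gX Xx X0]] := ker_extension Um x.
have [Y [gY Yy Y0]] := ker_extension Um y.
have [gX' Xx'] := push_at gX Xx; have [gY' Yy'] := push_at gY Yy.
apply: isoH_val_inj; rewrite tauE /= (iso_lieP oU Um gX gY)//.
rewrite (iso_lieP oU' U'm gX' gY')//; apply/eqP; rewrite -subr_eq0; apply/eqP.
exact: (defect_eq0 oU oU' Um U'm resA' minA' cphi).
Qed.

Lemma tau_act (x : isoH A m 1) (u : isoH A m 2) :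
  tau (iso_act x u) = iso_act (tau x : isoH A' m 1) (tau u).
Proof.
have [X [gX Xx X0]] := ker_extension Um x.
have [Y gY Yu] := section_extension (E := A 2%N) u Um.
have [gX' Xx'] := push_at gX Xx.
have [gY' Yu'] := @push_at 2 Y u gY Yu.
have [Phi [Pl Ps Pg Pd]] := defect_primitive oU oU' Um U'm resA' cphi.
rewrite [LHS](tauE (iso_act x u)) /= (iso_actP oU Um gX gY)//.
rewrite (iso_actP oU' U'm gX' gY')//.
exact: (push_bra2 oU oU' Um U'm resA' minA minA' cphi Pl Ps Pg Pd).
Qed.

Lemma tau_cochain3 : ce_cohomologous (@iso_lie _ _ _ A m)
  (fun x (u : isoH A' m 2) => iso_act (tau x) u) 3
  (fun s => tau (iso_cochain3 s)) (fun s => iso_cochain3 (map (@tau 1) s)).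
Proof.
have [Phi [Pl Ps Pg Pd]] := defect_primitive oU oU' Um U'm resA' cphi.
have Plm := nbhs_singleton Pl; have Psm := nbhs_singleton Ps.
(* Phi at m takes values in the second H^{-2}, on which the first isotropy Lie algebra acts through
   tau; its differential is the sum of corrections in [push_tri]. *)
exists (fun s => if s is [:: x; y] then Phi m (ker_val x) (ker_val y) else 0).
  split.
  - case=> [|s [|? ?]] [|u [|? ?]] a x y //= _.
    rewrite Psm Plm (Psm (ker_val s) (ker_val x)) (Psm (ker_val s) (ker_val y)).
    module_eq R.
  - case=> [|x [|y [|? ?]]] // _; rewrite /= !inE.
    have [<- _|//] := eqVneq x y; exact: eqN_eq0.
case=> [|x [|y [|z [|? ?]]]] // _; rewrite ce_diff3.
have [X [gX Xx X0]] := ker_extension Um x.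
have [Y [gY Yy Y0]] := ker_extension Um y.
have [Z [gZ Zz Z0]] := ker_extension Um z.
have [gX' Xx'] := push_at gX Xx; have [gY' Yy'] := push_at gY Yy.
have [gZ' Zz'] := push_at gZ Zz.
rewrite [X in X - _](tauE (iso_cochain3 [:: x; y; z])) /=.
rewrite (iso_cochain3P oU Um gX gY gZ)// (iso_cochain3P oU' U'm gX' gY' gZ')//.
rewrite (push_tri oU oU' Um U'm resA' minA' cphi Pg Pd gX gY gZ).
have Pgm := nbhs_singleton Pg.
rewrite (iso_actP oU' U'm gX' (Pgm _ _ gY gZ))// ?Yy ?Zz//.
rewrite (iso_actP oU' U'm gY' (Pgm _ _ gX gZ))// ?Xx ?Zz//.
rewrite (iso_actP oU' U'm gZ' (Pgm _ _ gX gY))// ?Xx ?Yy//.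
rewrite (iso_lieP oU Um gX gY)// (iso_lieP oU Um gX gZ)//.
rewrite (iso_lieP oU Um gY gZ)// /correction -Xx -Yy -Zz; module_eq R.
Qed.

End IsotropyComparison.

Theorem proposition4p27 (R : realType) (M : manifold R)
    (F : singular_foliation M) (m : M) :
  (exists (U : set M) (C : anchored_bundles U),
     [/\ open U, U m, geometric_resolution F C & finite_length C]) ->
  forall (U : set M) (A : lie_infty_algebroid U),
    open U -> U m -> universal F A -> minimal_at A m ->
  [/\ is_lie_algebra (@iso_lie _ _ _ A m),
      is_lie_module (@iso_lie _ _ _ A m) (@iso_act _ _ _ A m),
      ce_cocycle (@iso_lie _ _ _ A m) (@iso_act _ _ _ A m) 3
        (@iso_cochain3 _ _ _ A m)
    & forall (U' : set M) (A' : lie_infty_algebroid U'),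
        open U' -> U' m -> universal F A' -> minimal_at A' m ->
        exists tau : forall i, isoH A m i -> isoH A' m i,
        [/\ canonical_iso tau,
            forall x y, tau 1%N (iso_lie x y) = iso_lie (tau 1%N x) (tau 1%N y),
            forall x u, tau 2%N (iso_act x u) = iso_act (tau 1%N x) (tau 2%N u)
          & ce_cohomologous (@iso_lie _ _ _ A m)
              (fun x (u : isoH A' m 2) => iso_act (tau 1%N x) u) 3
              (fun s => tau 2%N (iso_cochain3 s))
              (fun s => iso_cochain3 (map (tau 1%N) s))]].
Proof.
move=> _ U A oU Um resA minA; split.
- exact: iso_lie_algebra.
- exact: iso_lie_module.
- exact: iso_ce_cocycle.
move=> U' A' oU' U'm resA' minA'.
have [phi cphi] := comparison_exists oU oU' resA resA' Um U'm.
have [tau ctau] := canonical_iso_exists oU oU' Um U'm resA resA' minA minA'.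
have [_ /(_ phi cphi) tauE _] := ctau.
exists tau; split => //.
- exact: (tau_lie oU oU' Um U'm resA' minA' cphi tauE).
- exact: (tau_act oU oU' Um U'm resA' minA minA' cphi tauE).
- exact: (tau_cochain3 oU oU' Um U'm resA' minA' cphi tauE).
Qed.
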